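(* For real parameters $\rho_\alpha,\rho_\beta\ge 0$ let $$\mathcal W_n(\rho_\alpha,\rho_\beta):=2^n\min_{a_1,\dots,a_n}\ \max_{x\in[-1,1]}(1-x)^{\rho_\alpha}(1+x)^{\rho_\beta}\left|\prod_{k=1}^n(x-a_k)\right|.$$ For any value of the parameters $\rho_\alpha,\rho_\beta\ge 0$, we have $\mathcal W_n(\rho_\alpha,\rho_\beta)\sim 2^{1-\rho_\alpha-\rho_\beta}$ as $n\to\infty$. Furthermore: 1. If $\rho_\alpha,\rho_\beta\in\{0,1/2\}$, then the quantity $\mathcal W_n(\rho_\alpha,\rho_\beta)$ is constant (in $n$). 2. If $\rho_\alpha,\rho_\beta\in[0,1/2]$, then $$\sup_n\mathcal W_n(\rho_\alpha,\rho_\beta)=2^{1-\rho_\alpha-\rho_\beta}.$$ 3. If $\rho_\alpha,\rho_\beta\in\{0\}\cup[1/2,\infty)$, then $$\inf_n\mathcal W_n(\rho_\alpha,\rho_\beta)=2^{1-\rho_\alpha-\rho_\beta},$$ $$\sup_n\mathcal W_n(\rho_\alpha,\rho_\beta)\le\left(\frac{2\rho_\alpha}{\rho_\alpha+\rho_\beta}\right)^{\rho_\alpha}\left(\frac{2\rho_\beta}{\rho_\alpha+\rho_\beta}\right)^{\rho_\beta},$$ and $\mathcal W_n(\rho_\alpha,\rho_\beta)$ decreases monotonically as $n$ increases.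
   Context: The quantity $\mathcal W_n(\rho_\alpha,\rho_\beta)$ is called the Widom factor; $n$ is the degree of the monic polynomial $\prod_{k=1}^n(x-a_k)$, and the minimum is taken over all choices of the nodes $a_1,\dots,a_n$ (it is attained, by a unique set of nodes, all lying in $[-1,1]$). The notation $f(n)\sim g(n)$ as $n\to\infty$ means $f(n)/g(n)\to 1$ as $n\to\infty$.
   Formalization: The upper bound on sup_n W_n in item 3 is stated only for (ρ_α,ρ_β) ≠ (0,0): at ρ_α=ρ_β=0 its right-hand side is 0/0, and reading it as 1 would be false because W_n(0,0)=2. *)

(* Defs.v *)
From mathcomp Require Import all_boot all_order all_algebra.
From mathcomp Require Import all_classical all_reals all_analysis.
From mathcomp Require Import complex.
Set Implicit Arguments.
Unset Strict Implicit.
Unset Printing Implicit Defensive.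
Import Order.TTheory GRing.Theory Num.Theory.
Import numFieldNormedType.Exports.
Local Open Scope classical_set_scope.
Local Open Scope ring_scope.

(* [powR] satisfies [0 `^ 0 = 1] and [0 `^ r = 0] for [r != 0], so a zero
   exponent gives the constant weight 1, endpoints included. *)
Definition jacobi_weight (R : realType) (ra rb x : R) : R :=
  (1 - x) `^ ra * (1 + x) `^ rb.

(* For [0 <= ra], [0 <= rb] the function is continuous on [-1, 1], so this
   supremum is a maximum.  [normc] is the real-valued complex modulus. *)
Definition weighted_max (R : realType) (ra rb : R) (n : nat)
    (a : 'I_n -> R[i]) : R :=
  sup [set jacobi_weight ra rb x
           * ComplexField.Normc.normc (\prod_(k < n) (x%:C%C - a k))
      | x in `[-1, 1]].

(* The nodes are arbitrary complex numbers, so that the infimum, which is a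
   minimum, runs over all monic polynomials of degree n. *)
Definition widom (R : realType) (ra rb : R) (n : nat) : R :=
  2 ^+ n * inf (range (@weighted_max R ra rb n)).

(* Main.v *)
(* On the unit circle z = e^(i theta), with x = cos theta and L = n + ra + rb, the
   weighted polynomial 2^L w(x) |T(x)| is the modulus of P(z), a product of powers
   |z - zeta|^c over points zeta of the circle: c = 1 at the preimages of the zeros
   of T, c = 2 ra at 1 and c = 2 rb at -1.  Write p = z P'/P; on the circle
   Re p = L and z p' > 0.  For L' > 0 consider H = (L + L') P - z P', whose modulus
   on the circle is the square root of L'^2 f^2 + f'^2 for f = |P|.  At a point of
   the circle where |H| is critical, either f' = 0 or f'' = - L'^2 f, and in the
   second case z H'/H = L - L'.
   If all c >= 1 and L' > L, the maximum principle forbids z H'/H < 0 at a maximum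
   of |H|, so |H| <= L' max f; letting L' tend to L gives the Bernstein-Szego
   inequality, hence |cos theta f + sin theta f'/L| <= max f, and this combination
   is w times twice a monic polynomial of degree n + 1: the Widom factors decrease.
   If all c <= 1 and L' < L, the maximum principle for 1/H forbids z H'/H > 0 at a
   minimum of |H|, so L + L' = |H(0)| bounds L' times the smallest critical value
   of f; as the extremal f equioscillates, L' -> L gives 2^L max(w |T|) <= 2.
   The limit is obtained by comparison with 2 Re(z^(-n) Q(z)) for polynomials
   Q = (1 + A/J)^J approximating powers of 1 - z and 1 + z on the circle, combined
   with de la Vallee-Poussin's alternation argument for the lower bound. *)

Require Import Defs.
From mathcomp Require Import all_boot all_order all_algebra.
From mathcomp Require Import all_classical all_reals all_analysis.
From mathcomp Require Import complex ring lra.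
Import Order.TTheory GRing.Theory Num.Theory.
Import numFieldNormedType.Exports.
Local Open Scope classical_set_scope.
Local Open Scope ring_scope.
Set Implicit Arguments.
Unset Strict Implicit.
Unset Printing Implicit Defensive.

(** * Moduli of complex numbers *)

Local Notation normc := ComplexField.Normc.normc.

Section Modulus.
Variable R : realType.
Implicit Types (z w : R[i]) (x y c : R).

Lemma normc_ge0 z : 0 <= normc z.
Proof. by case: z => x y; exact: sqrtr_ge0. Qed.

Lemma normc_sqr z : normc z ^+ 2 = complex.Re z ^+ 2 + complex.Im z ^+ 2.
Proof. by case: z => x y; rewrite sqr_sqrtr// addr_ge0// sqr_ge0. Qed.

Lemma normc_eq0 z : (normc z == 0) = (z == 0).
Proof.
apply/eqP/eqP => [|->]; last exact: ComplexField.Normc.normc0.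
exact: ComplexField.Normc.eq0_normc.
Qed.

Lemma normc_gt0 z : (0 < normc z) = (z != 0).
Proof. by rewrite lt_def normc_ge0 andbT normc_eq0. Qed.

Lemma normc_real x : normc (x%:C)%C = `|x|.
Proof. by rewrite /= expr0n addr0 sqrtr_sqr. Qed.

Lemma normc_prod (I : Type) (r : seq I) (P : pred I) (f : I -> R[i]) :
  normc (\prod_(i <- r | P i) f i) = \prod_(i <- r | P i) normc (f i).
Proof.
apply: (big_morph _ _ (ComplexField.Normc.normc1 R)).
by move=> a b; exact: ComplexField.Normc.normcM.
Qed.

Lemma normcX z n : normc (z ^+ n) = normc z ^+ n.
Proof.
elim: n => [|n ih]; first by rewrite !expr0 ComplexField.Normc.normc1.
by rewrite !exprS ComplexField.Normc.normcM ih.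
Qed.

Lemma normc_le_add z w : normc (z + w) <= normc z + normc w.
Proof. exact: le_normcD. Qed.

Lemma normc_subC z w : normc (z - w) = normc (w - z).
Proof. by rewrite -opprB (@normcN R). Qed.

Lemma normc_conj z : normc (z^*)%C = normc z.
Proof. by case: z => x y /=; rewrite sqrrN. Qed.

Lemma normc_ge_Re z : `|complex.Re z| <= normc z.
Proof.
rewrite -sqrtr_sqr -[leRHS]ger0_norm ?normc_ge0// -sqrtr_sqr ler_sqrt ?sqr_ge0//.
by rewrite normc_sqr lerDl sqr_ge0.
Qed.

Lemma ReM z w : complex.Re (z * w) =
  complex.Re z * complex.Re w - complex.Im z * complex.Im w.
Proof. by case: z w => [a b] [c d]. Qed.

Lemma ImM z w : complex.Im (z * w) =
  complex.Re z * complex.Im w + complex.Im z * complex.Re w.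
Proof. by case: z w => [a b] [c d]. Qed.

Lemma ReZ x z : complex.Re ((x%:C)%C * z) = x * complex.Re z.
Proof. by rewrite ReM /= mul0r subr0. Qed.

Lemma ImZ x z : complex.Im ((x%:C)%C * z) = x * complex.Im z.
Proof. by rewrite ImM /= mul0r addr0. Qed.

Lemma ReD z w : complex.Re (z + w) = complex.Re z + complex.Re w.
Proof. by case: z w => [a b] [c d]. Qed.

Lemma ImD z w : complex.Im (z + w) = complex.Im z + complex.Im w.
Proof. by case: z w => [a b] [c d]. Qed.

Lemma ReN z : complex.Re (- z) = - complex.Re z.
Proof. by case: z. Qed.

Lemma ImN z : complex.Im (- z) = - complex.Im z.
Proof. by case: z. Qed.

Lemma ln1D_ge x : `|x| <= 2^-1 -> x - x ^+ 2 *+ 2 <= ln (1 + x).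
Proof.
move=> x2; have x1 : 0 < 1 + x by move: x2; rewrite ler_norml => /andP[]; lra.
have : ln ((1 + x)^-1) <= (1 + x)^-1 - 1.
  by rewrite -{1}(subrK 1 (1 + x)^-1) addrC le_ln1Dx// ltrBrDl subrr invr_gt0.
rewrite lnV// => h; suff : (1 + x)^-1 - 1 <= - (x - x ^+ 2 *+ 2) by lra.
have -> : (1 + x)^-1 - 1 = - x + x ^+ 2 / (1 + x) by field; lra.
rewrite opprB addrC lerD2r mulr2n -mulr2n -mulr_natr.
rewrite ler_wpM2l ?sqr_ge0// -[2%:R]invrK lef_pV2 ?posrE//.
by move: x2; rewrite ler_norml => /andP[]; lra.
Qed.

Lemma normc1D_powR_ge (X : R[i]) c : exists2 C, 0 <= C & exists2 t0, 0 < t0 &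
  forall t, 0 <= t <= t0 ->
  expR (c * (t * complex.Re X) - C * t ^+ 2) <= normc (1 + (t%:C)%C * X) `^ c.
Proof.
set a := complex.Re X.
have [N NE] : exists N, N = normc X ^+ 2 by exists (normc X ^+ 2).
have N0 : 0 <= N by rewrite NE sqr_ge0.
have a0 := normr_ge0 a.
pose D := `|c| * (N + (2 * `|a| + N) ^+ 2 *+ 2) + `|c| * N.
exists D.
  by rewrite /D -mulrDr mulr_ge0//; have := sqr_ge0 (2 * `|a| + N); lra.
exists (2 * (1 + 2 * `|a| + N))^-1; first by rewrite invr_gt0; lra.
move=> t /andP[t0 tle].
have tM : t * (1 + 2 * `|a| + N) <= 2^-1.
  rewrite -ler_pdivlMr; last lra.
  by rewrite -invfM.
have t1 : t <= 1 by nra.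
set u := 2 * t * a + t ^+ 2 * N.
have nE : normc (1 + (t%:C)%C * X) = expR (2^-1 * ln (1 + u)) /\ 0 < 1 + u /\
    `|u| <= t * (2 * `|a| + N) /\ `|u| <= 2^-1.
  have ub : `|u| <= t * (2 * `|a| + N).
    have tN : 0 <= t ^+ 2 * N by rewrite mulr_ge0// sqr_ge0.
    rewrite /u (le_trans (ler_normD _ _))// (ger0_norm tN) normrM.
    have tt : t ^+ 2 * N <= t * N by rewrite ler_wpM2r// expr2 ler_piMl.
    by rewrite (ger0_norm (_ : 0 <= 2 * t)); lra.
  have u2 : `|u| <= 2^-1 by apply: (le_trans ub); nra.
  have up : 0 < 1 + u by move: u2; rewrite ler_norml => /andP[]; lra.
  split=> //.
  have -> : normc (1 + (t%:C)%C * X) = Num.sqrt (1 + u).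
    have sq : normc (1 + (t%:C)%C * X) ^+ 2 = 1 + u.
      rewrite normc_sqr ReD ImD ReM ImM /= !mul0r subr0 !add0r addr0 -/a /u NE.
      by rewrite normc_sqr -/a; ring.
    by rewrite -sq sqrtr_sqr ger0_norm// normc_ge0.
  by rewrite -powR12_sqrt 1?ltW// /powR gt_eqF.
case: nE => -> [up [ub u2]].
have -> : expR (2^-1 * ln (1 + u)) `^ c = expR (c / 2 * ln (1 + u)).
  by rewrite -expRM; congr expR; ring.
rewrite ler_expR.
have l1 := ln1D_ge u2.
have l2 : ln (1 + u) <= u by rewrite le_ln1Dx//; lra.
have usq : u ^+ 2 <= t ^+ 2 * (2 * `|a| + N) ^+ 2.
  by rewrite -exprMn -real_normK ?num_real// ler_pXn2r ?nnegrE//; nra.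
suff : `|c / 2 * ln (1 + u) - c * (t * a)| <= D * t ^+ 2.
  by rewrite ler_norml => /andP[]; lra.
have -> : c / 2 * ln (1 + u) - c * (t * a) = c / 2 * (ln (1 + u) - u + t ^+ 2 * N).
  by rewrite /u; field.
have lu : `|ln (1 + u) - u| <= t ^+ 2 * (2 * `|a| + N) ^+ 2 *+ 2.
  by rewrite ler_norml; apply/andP; split; lra.
rewrite normrM (le_trans (ler_wpM2l _ (ler_normD _ _)))//.
rewrite (ger0_norm (_ : 0 <= t ^+ 2 * N)) ?mulr_ge0 ?sqr_ge0//.
rewrite normrM (ger0_norm (_ : 0 <= 2^-1)) //.
have c0 := normr_ge0 c.
have t2 : 0 <= t ^+ 2 by rewrite sqr_ge0.
rewrite (le_trans (ler_wpM2l _ (lerD lu (lexx _)))) ?mulr_ge0//.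
rewrite /D; set s := (2 * `|a| + N) ^+ 2; have s0 : 0 <= s by rewrite sqr_ge0.
have h1 : 0 <= `|c| * t ^+ 2 * N by rewrite !mulr_ge0.
have h2 : 0 <= `|c| * t ^+ 2 * s by apply: mulr_ge0 => //; exact: mulr_ge0.
lra.
Qed.

End Modulus.

(** * The maximum principle for products of powers of distances *)

#[local] Arguments ComplexField.Normc.normc : simpl never.

Section MaximumPrinciple.
Variable R : realType.
Implicit Types (s : seq (R[i] * R)) (z w : R[i]) (c : R).

Definition mprod s z := \prod_(p <- s) normc (z - p.1) `^ p.2.

Lemma mprod_ge0 s z : 0 <= mprod s z.
Proof. by apply: prodr_ge0 => p _; exact: powR_ge0. Qed.

Lemma mprod_cons p s z : mprod (p :: s) z = normc (z - p.1) `^ p.2 * mprod s z.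
Proof. by rewrite /mprod big_cons. Qed.

Lemma mprod_nil z : mprod [::] z = 1.
Proof. by rewrite /mprod big_nil. Qed.

Lemma mprod_cat s s' z : mprod (s ++ s') z = mprod s z * mprod s' z.
Proof. by rewrite /mprod big_cat. Qed.

(* The mean of [ln |.|] over [w + h, w - h, w + ih, w - ih] is [ln |w| + O(h^4)],
   since the product of these four numbers is [w^4 - h^4]. *)
Lemma four_point_factor w c : exists2 C, 0 <= C & exists2 t0, 0 < t0 &
  forall h : R, h ^+ 4 <= t0 ->
  expR (- (C * h ^+ 4)) * (normc w `^ c) ^+ 4 <=
  normc (w + (h%:C)%C) `^ c * normc (w - (h%:C)%C) `^ c *
  (normc (w + (h *i)%C) `^ c * normc (w - (h *i)%C) `^ c).
Proof.
have [->|w0] := eqVneq w 0.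
  exists 0 => //; exists 1 => // h _.
  rewrite mul0r oppr0 expR0 mul1r.
  have [->|c0] := eqVneq c 0; first by rewrite !powRr0 !mulr1 expr1n.
  rewrite ComplexField.Normc.normc0 powR0// expr0n/=.
  by rewrite !mulr_ge0 ?powR_ge0.
have [C C0 [t0 t00 CP]] := normc1D_powR_ge (- (w ^- 4)) c.
set a := complex.Re (- w ^- 4).
exists (`|c| * `|a| + C); first by rewrite addr_ge0// mulr_ge0.
exists (Num.min t0 1); first by rewrite lt_min t00 ltr01.
move=> h; rewrite le_min => /andP[ht h1].
have h0 : 0 <= h ^+ 4 by rewrite (exprM h 2 2) sqr_ge0.
have -> : normc (w + (h%:C)%C) `^ c * normc (w - (h%:C)%C) `^ c *
  (normc (w + (h *i)%C) `^ c * normc (w - (h *i)%C) `^ c) =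
  (normc w `^ c) ^+ 4 * normc (1 + ((h ^+ 4)%:C)%C * - w ^- 4) `^ c.
  rewrite -[(normc w `^ c) ^+ 4]powR_mulrn ?powR_ge0// -powRrM (mulrC c) powRrM.
  rewrite powR_mulrn ?normc_ge0// -!powRM ?mulr_ge0 ?exprn_ge0 ?normc_ge0//.
  rewrite -normcX -!ComplexField.Normc.normcM; congr (normc _ `^ c).
  have -> : (h *i)%C = 'i%C * (h%:C)%C :> R[i] by simpc.
  rewrite rmorphXn/=.
  have i2 : 'i%C * 'i%C = -1 :> R[i] by rewrite -expr2 sqr_i.
  transitivity (w ^+ 4 - (h%:C)%C ^+ 4 : R[i]); last first.
    by field; rewrite w0.
  have -> : (w + 'i%C * (h%:C)%C) * (w - 'i%C * (h%:C)%C) =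
    w ^+ 2 - 'i%C * 'i%C * (h%:C)%C ^+ 2 :> R[i] by ring.
  by rewrite i2; ring.
rewrite mulrC ler_wpM2l// ?exprn_ge0 ?powR_ge0//.
apply: le_trans (CP _ _); last by rewrite h0 ht.
rewrite ler_expR -/a mulrDl opprD.
move: (h ^+ 4) h0 h1 => k k0 k1; rewrite lerD//.
  by have := ler_norm (- (c * (k * a))); rewrite normrN !normrM (ger0_norm k0); lra.
by rewrite lerN2 ler_wpM2l// expr2; nra.
Qed.

Lemma four_point s z : exists2 C, 0 <= C & exists2 t0, 0 < t0 &
  forall h : R, h ^+ 4 <= t0 ->
  expR (- (C * h ^+ 4)) * mprod s z ^+ 4 <=
  mprod s (z + (h%:C)%C) * mprod s (z - (h%:C)%C) *
  (mprod s (z + (h *i)%C) * mprod s (z - (h *i)%C)).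
Proof.
elim: s => [|[x c] s [C C0 [t0 t00 ih]]].
  by exists 0 => //; exists 1 => // h _; rewrite !mprod_nil mul0r oppr0 expR0
    expr1n !mulr1.
have [D D0 [u0 u00 ihD]] := four_point_factor (z - x) c.
exists (D + C); first exact: addr_ge0.
exists (Num.min u0 t0); first by rewrite lt_min u00.
move=> h; rewrite le_min => /andP[hu ht].
rewrite !mprod_cons/=.
have -> y : z + y - x = z - x + y by rewrite addrAC.
have := ler_pM _ _ (ihD h hu) (ih h ht).
rewrite !mulr_ge0 ?expR_ge0 ?exprn_ge0 ?powR_ge0 ?mprod_ge0//.
move=> /(_ isT isT) H.
rewrite mulrDl opprD expRD exprMn.
move: H; rewrite !(addrAC _ _ (- x)).
by congr (is_true (_ <= _)); ring.
Qed.

Definition toC (u : R * R) : R[i] := (u.1 +i* u.2)%C.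

Lemma powR_continuous_nonneg (T : topologicalType) (f : T -> R) c (u : T) :
  (forall x, 0 <= f x) -> 0 <= c \/ f u != 0 -> {for u, continuous f} ->
  {for u, continuous (fun x => f x `^ c)}.
Proof.
move=> f0 cfu cf.
have [->|c0] := eqVneq c 0.
  have -> : (fun x => f x `^ 0) = cst 1 by apply/funext => x; rewrite powRr0.
  exact: cst_continuous.
have [fu|fu] := eqVneq (f u) 0; last first.
  have fu0 : 0 < f u by rewrite lt_def fu f0.
  apply: (@continuous_comp _ _ _ f (fun a => a `^ c)) => //.
  apply: differentiable_continuous; apply/derivable1_diffP.
  by apply: derivable_powR; rewrite in_itv/= fu0.
have cp : 0 < c by case: cfu; rewrite ?fu ?eqxx// lt_def c0.
rewrite /prop_for /continuous_at fu powR0//.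
apply/cvgrPdist_lt => e e0.
move: cf; rewrite /prop_for /continuous_at fu => /cvgrPdist_lt.
move=> /(_ (e `^ c^-1)); rewrite powR_gt0// => /(_ isT).
apply: filterS => x; rewrite !sub0r !normrN.
rewrite ger0_norm// ger0_norm ?powR_ge0// => /(gt0_ltr_powR cp).
rewrite !nnegrE f0 powR_ge0 => /(_ isT isT).
by rewrite -powRrM mulVf// powRr1// ltW.
Qed.

Lemma toC_dist_continuous z : continuous (fun u => normc (toC u - z)).
Proof.
move=> u; rewrite /toC; case: z => a b; rewrite /ComplexField.Normc.normc /=.
have c1 : {for u, continuous (fun u : R * R => (u.1 - a) ^+ 2 + (u.2 - b) ^+ 2)}.
  apply: cvgD.
    by apply: cvgM; (apply: cvgB; [exact: cvg_fst|exact: cvg_cst]).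
  by apply: cvgM; (apply: cvgB; [exact: cvg_snd|exact: cvg_cst]).
by apply: (continuous_comp c1); exact: sqrt_continuous.
Qed.

Lemma mprod_continuous s u :
  (forall p, p \in s -> 0 <= p.2 \/ toC u != p.1) ->
  {for u, continuous (fun v => mprod s (toC v))}.
Proof.
elim: s => [|p s ih] H.
  have -> : (fun v => mprod [::] (toC v)) = cst 1.
    by apply/funext => v; rewrite mprod_nil.
  exact: cst_continuous.
have -> : (fun v => mprod (p :: s) (toC v)) =
    (fun v => normc (toC v - p.1) `^ p.2 * mprod s (toC v)).
  by apply/funext => v; rewrite mprod_cons.
apply: cvgM; last by apply: ih => q qs; apply: H; rewrite inE qs orbT.
apply: powR_continuous_nonneg.
- by move=> v; exact: normc_ge0.
- by case: (H p (mem_head _ _)) => [|h]; [left|right; rewrite normc_eq0 subr_eq0].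
- exact: toC_dist_continuous.
Qed.

Lemma disc_compact : compact [set u : R * R | normc (toC u) <= 1].
Proof.
have box := compact_setX (@segment_compact R (-1) 1) (@segment_compact R (-1) 1).
apply: (subclosed_compact _ box).
  have -> : [set u : R * R | normc (toC u) <= 1] =
      (fun u => normc (toC u - 0)) @^-1` [set x | x <= 1].
    by apply/funext => u; rewrite /preimage /mkset (subr0 (toC u)).
  apply: preimage_closed; last exact: closed_le.
  by move=> u _; exact: toC_dist_continuous.
move=> [x y] /=; rewrite -(@ler_pXn2r _ 2) ?nnegrE ?normc_ge0//.
rewrite normc_sqr expr1n/= => H; have x2 := sqr_ge0 x; have y2 := sqr_ge0 y.
by split; rewrite /= in_itv/= -ler_norml -(@ler_pXn2r _ 2) ?nnegrE//
  real_normK ?num_real// expr1n; lra.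
Qed.

Lemma circle_compact : compact [set u : R * R | normc (toC u) = 1].
Proof.
apply: (subclosed_compact _ disc_compact); last by move=> u /= ->.
have -> : [set u : R * R | normc (toC u) = 1] =
    (fun u => normc (toC u - 0)) @^-1` [set 1].
  by apply/funext => u; rewrite /preimage /mkset (subr0 (toC u)).
apply: preimage_closed; last exact: closed_eq.
by move=> u _; exact: toC_dist_continuous.
Qed.

Lemma toC_surj z : exists u, toC u = z.
Proof. by case: z => a b; exists (a, b). Qed.

Definition disc_regular s :=
  forall p, p \in s -> 0 <= p.2 \/ 1 < normc p.1.

Lemma disc_regular_continuous s u : disc_regular s -> normc (toC u) <= 1 ->
  {for u, continuous (fun v => mprod s (toC v))}.
Proof.
move=> H u1; apply: mprod_continuous => p /H[|p1]; [by left|right].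
by apply/eqP => up; move: p1; rewrite -up ltNge u1.
Qed.

Lemma circle_max s : disc_regular s ->
  exists2 z0, normc z0 = 1 & forall z, normc z = 1 -> mprod s z <= mprod s z0.
Proof.
move=> H; have := @compact_EVT_max _ R (fun v => mprod s (toC v)) _ _ circle_compact.
case.
- exists (1, 0) => /=; rewrite (_ : toC _ = 1)//.
  exact: ComplexField.Normc.normc1.
- apply: continuous_in_subspaceT => u; rewrite inE/= => u1.
  by apply: disc_regular_continuous => //; rewrite u1.
move=> u; rewrite inE/= => u1 um; exists (toC u) => // z.
have [v <-] := toC_surj z => v1; apply: um; rewrite inE/=.
exact: v1.
Qed.

Lemma le_mul_expR_le (x K : R) :
  (forall e, 0 < e -> x <= K * expR e) -> x <= K.
Proof.
move=> H; rewrite leNgt; apply/negP => Kx.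
have [K0|K0] := ltrP 0 K; last first.
  have := H 1 ltr01; rewrite leNgt => /negP; apply.
  by apply: le_lt_trans Kx; rewrite -[leRHS]mulr1 ler_wnM2l// -expR0 ler_expR.
have x0 := lt_trans K0 Kx.
have l0 : 0 < ln (x / K) by rewrite ln_gt0// ltr_pdivlMr// mul1r.
have := H (ln (x / K) / 2); rewrite divr_gt0// => /(_ isT).
rewrite leNgt => /negP; apply.
rewrite -[X in _ < X](divfK (lt0r_neq0 K0)) mulrC ltr_pM2r//.
rewrite -[ltRHS]lnK ?posrE ?divr_gt0// ltr_expR; lra.
Qed.

Lemma mprod_max_principle s K : disc_regular s ->
  (forall z, normc z = 1 -> mprod s z <= K) ->
  forall z, normc z <= 1 -> mprod s z <= K.
Proof.
move=> H HK z1 z11.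
have K0 : 0 <= K.
  by apply: le_trans (HK 1 _); [exact: mprod_ge0|exact: ComplexField.Normc.normc1].
apply: le_mul_expR_le => e e0.
pose W z := mprod s z * expR (e * normc z ^+ 2).
suff [p p1 pm] : exists2 p, normc p <= 1 &
    (forall z, normc z <= 1 -> W z <= W p) /\ (normc p = 1 \/ mprod s p = 0).
  case: pm => pm pc; apply: (@le_trans _ _ (W z1)).
    rewrite /W ler_peMr ?mprod_ge0// -expR0 ler_expR.
    by rewrite mulr_ge0 ?sqr_ge0// ltW.
  apply: (le_trans (pm _ z11)); case: pc => pc.
    by rewrite /W pc expr1n mulr1 ler_wpM2r ?expR_ge0// HK.
  by rewrite /W pc mul0r mulr_ge0 ?expR_ge0.
have := @compact_EVT_max _ R (fun v => W (toC v)) _ _ disc_compact; case.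
- by exists (0, 0) => /=; rewrite (_ : toC _ = 0)// ComplexField.Normc.normc0.
- apply: continuous_in_subspaceT => u; rewrite inE/= => u1.
  apply: cvgM; first exact: disc_regular_continuous.
  apply: (@continuous_comp _ _ _ (fun v => e * normc (toC v) ^+ 2) (@expR R));
    last exact: continuous_expR.
  apply: cvgM; first exact: cvg_cst.
  have cu : {for u, continuous (fun v : R * R => normc (toC v))}.
    have -> : (fun v => normc (toC v)) = (fun v => normc (toC v - 0)).
      by apply/funext => v; rewrite (subr0 (toC v)).
    exact: toC_dist_continuous.
  exact: cvgM.
move=> u; rewrite inE/= => u1 um; exists (toC u) => //.
have {}um z : normc z <= 1 -> W z <= W (toC u).
  have [v <-] := toC_surj z => v1; apply: um; rewrite inE/=.
  exact: v1.
split=> //; move: u1; rewrite le_eqVlt => /predU1P[|u1]; first by left.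
right; apply/eqP; rewrite -[_ == 0]negbK; apply/negP => m0.
have {m0} m0 : 0 < mprod s (toC u) by rewrite lt_def m0 mprod_ge0.
move: (toC u) u1 um m0 => p p1 um m0.
have [C C0 [t0 t00 CP]] := four_point s p.
pose h := Num.min (Num.min 1 t0) (Num.min (1 - normc p) (e / (1 + C))).
have h0 : 0 < h.
  by rewrite /h !lt_min ltr01 t00 subr_gt0 p1 divr_gt0//; lra.
have : h <= h by [].
rewrite {2}/h !le_min => /andP[/andP[h1 ht] /andP[hp hC]].
have hh : h ^+ 2 <= h by rewrite expr2; nra.
have h4 : h ^+ 4 <= t0.
  by rewrite (exprM h 2 2); apply: le_trans ht; rewrite expr2; nra.
have {CP} CP := CP h h4.
have in_disc w : normc w = h -> W (p + w) <= W p.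
  by move=> wh; apply: um; rewrite (le_trans (normc_le_add _ _))// wh; lra.
have nh : normc (h%:C)%C = h by rewrite normc_real ger0_norm// ltW.
have nih : normc (h *i)%C = h.
  by rewrite /ComplexField.Normc.normc/= expr0n add0r sqrtr_sqr ger0_norm// ltW.
have b1 := in_disc _ nh.
have b2 : W (p - (h%:C)%C) <= W p by apply: in_disc; rewrite (@normcN R).
have b3 := in_disc _ nih.
have b4 : W (p - (h *i)%C) <= W p by apply: in_disc; rewrite (@normcN R).
have W0 w : 0 <= W w by rewrite mulr_ge0 ?mprod_ge0 ?expR_ge0.
have := ler_pM (mulr_ge0 (W0 _) (W0 _)) (mulr_ge0 (W0 _) (W0 _))
  (ler_pM (W0 _) (W0 _) b1 b2) (ler_pM (W0 _) (W0 _) b3 b4).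
set E := expR (e * (4 * normc p ^+ 2 + 4 * h ^+ 2)).
have -> : W (p + (h%:C)%C) * W (p - (h%:C)%C) * (W (p + (h *i)%C) * W (p - (h *i)%C)) =
  mprod s (p + (h%:C)%C) * mprod s (p - (h%:C)%C) *
  (mprod s (p + (h *i)%C) * mprod s (p - (h *i)%C)) * E.
  have -> : E = expR (e * normc (p + (h%:C)%C) ^+ 2) *
     expR (e * normc (p - (h%:C)%C) ^+ 2) *
     (expR (e * normc (p + (h *i)%C) ^+ 2) * expR (e * normc (p - (h *i)%C) ^+ 2)).
    rewrite -!expRD /E; congr expR; rewrite !normc_sqr; case: (p) => a b /=.
    by ring.
  by rewrite /W; ring.
have -> : W p * W p * (W p * W p) = mprod s p ^+ 4 * expR (e * (4 * normc p ^+ 2)).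
  have -> : e * (4 * normc p ^+ 2) = 4%:R * (e * normc p ^+ 2) by ring.
  by rewrite expRM_natl /W; ring.
move=> le1; have := le_trans (ler_wpM2r (expR_ge0 _) CP) le1.
rewrite mulrAC mulrC ler_pM2l ?exprn_gt0// -expRD ler_expR.
have hC2 : h * (1 + C) <= e by rewrite -ler_pdivlMr//; lra.
have h2 : 0 < h ^+ 2 by rewrite exprn_gt0.
have Ch : C * h ^+ 4 <= e * h ^+ 2.
  rewrite (exprM h 2 2) expr2 mulrA ler_pM2r//.
  apply: le_trans (ler_wpM2l C0 hh) _; nra.
nra.
Qed.

Lemma mprod_ge_expR s z0 (eta : R[i]) :
  (forall p, p \in s -> z0 != p.1) ->
  exists2 C, 0 <= C & exists2 t0, 0 < t0 &
  forall t : R, 0 <= t <= t0 ->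
  expR (t * complex.Re (eta * \sum_(p <- s) (p.2%:C)%C * (z0 / (z0 - p.1)))
        - C * t ^+ 2) * mprod s z0 <= mprod s (z0 * (1 + (t%:C)%C * eta)).
Proof.
elim: s => [|[x c] s ih] H.
  exists 0 => //; exists 1 => // t _.
  by rewrite !mprod_nil big_nil mulr0 /= mulr0 mul0r subr0 expR0 mulr1.
case: ih => [p ps|C C0 [t0 t00 ih]]; first by apply: H; rewrite inE ps orbT.
have z0x : z0 - x != 0 by rewrite subr_eq0; apply: (H (x, c)); exact: mem_head.
have [D D0 [u0 u00 ihD]] := normc1D_powR_ge (eta * (z0 / (z0 - x))) c.
exists (D + C); first exact: addr_ge0.
exists (Num.min u0 t0); first by rewrite lt_min u00.
move=> t; rewrite le_min => /and3P[t_0 tu tt].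
rewrite !mprod_cons/=.
have -> : z0 * (1 + (t%:C)%C * eta) - x =
    (z0 - x) * (1 + (t%:C)%C * (eta * (z0 / (z0 - x)))).
  by field.
rewrite ComplexField.Normc.normcM powRM ?normc_ge0//.
have h1 := ihD t; rewrite t_0 tu in h1.
have h2 := ih t; rewrite t_0 tt in h2.
have := ler_pM (expR_ge0 _) _ (h1 isT) (h2 isT).
rewrite mulr_ge0 ?expR_ge0 ?mprod_ge0// => /(_ isT) h3.
have n0 := powR_ge0 (normc (z0 - x)) c.
have := ler_wpM2l n0 h3.
congr (is_true (_ <= _)); last by ring.
rewrite big_cons/= mulrDr ReD.
have -> : complex.Re (eta * ((c%:C)%C * (z0 / (z0 - x)))) =
    c * complex.Re (eta * (z0 / (z0 - x))).
  by rewrite mulrCA ReZ.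
set u := complex.Re _; set v := complex.Re _.
have -> : t * (c * u + v) - (D + C) * t ^+ 2 =
  (c * (t * u) - D * t ^+ 2) + (t * v - C * t ^+ 2) by ring.
by rewrite (expRD (c * (t * u) - D * t ^+ 2)); ring.
Qed.

(* The directions [z0 * (-1 + i k)], for all real [k], point into the disc. *)
Lemma mprod_boundary_max s z0 : normc z0 = 1 ->
  (forall p, p \in s -> z0 != p.1) -> 0 < mprod s z0 ->
  (forall z, normc z <= 1 -> mprod s z <= mprod s z0) ->
  let E := \sum_(p <- s) (p.2%:C)%C * (z0 / (z0 - p.1)) in
  complex.Im E = 0 /\ 0 <= complex.Re E.
Proof.
move=> z01 z0s m0 m1 E.
suff H (k : R) : complex.Re ((-1 +i* k)%C * E) <= 0.
  have h (k : R) : - complex.Re E - k * complex.Im E <= 0.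
    by have := H k; rewrite ReM/= mulN1r.
  have I0 : complex.Im E = 0.
    apply/eqP; apply/negP => /negP I0.
    have := h (- (1 + complex.Re E) / complex.Im E).
    by rewrite divfK//; lra.
  by split=> //; have := h 0; lra.
rewrite leNgt; apply/negP => pos; set a := complex.Re _ in pos.
have [C C0 [t0 t00 CP]] := @mprod_ge_expR s z0 (-1 +i* k)%C z0s.
pose t := Num.min (Num.min t0 (1 + k ^+ 2)^-1) (a / (2 * (1 + C))).
have k0 : 0 <= k ^+ 2 by rewrite sqr_ge0.
have t1 : 0 < t by rewrite /t !lt_min t00 invr_gt0 divr_gt0//=; lra.
have : t <= t by [].
rewrite {2}/t !le_min => /andP[/andP[tt tk] ta].
have := CP t; rewrite (ltW t1) tt => /(_ isT); rewrite -/E -/a.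
have tk1 : t * (1 + k ^+ 2) <= 1 by rewrite -ler_pdivlMr ?div1r//; lra.
have ta1 : t * (2 * (1 + C)) <= a by rewrite -ler_pdivlMr//; lra.
have/m1 : normc (z0 * (1 + (t%:C)%C * (-1 +i* k)%C)) <= 1.
  rewrite ComplexField.Normc.normcM z01 mul1r.
  rewrite -(@ler_pXn2r _ 2) ?nnegrE ?normc_ge0// normc_sqr/= expr1n.
  nra.
move=> h1 h2; have := le_trans h2 h1.
rewrite -[leRHS]mul1r ler_pM2r// -expR0 ler_expR; nra.
Qed.

End MaximumPrinciple.

(** * The Bernstein-Szego inequality on the circle and its mirror image *)

Section RootPolynomial.
Variable F : fieldType.
Implicit Types (r : seq F) (z : F).

Definition zpoly r : {poly F} := \prod_(x <- r) ('X - x%:P).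

Lemma zpoly_horner r z : (zpoly r).[z] = \prod_(x <- r) (z - x).
Proof. by rewrite /zpoly horner_prod; apply: eq_bigr => x _; rewrite hornerXsubC. Qed.

Lemma zpoly_neq0 r z : z \notin r -> (zpoly r).[z] != 0.
Proof.
rewrite zpoly_horner; elim: r => [|x r ih]; first by rewrite big_nil oner_eq0.
rewrite inE negb_or => /andP[zx /ih h].
by rewrite big_cons mulf_neq0// subr_eq0.
Qed.

Lemma zpoly_deriv r z : z \notin r ->
  (zpoly r)^`().[z] = (zpoly r).[z] * \sum_(x <- r) (z - x)^-1.
Proof.
rewrite /zpoly; elim: r => [|x r ih]; first by rewrite !big_nil derivC hornerC mulr0.
rewrite inE negb_or => /andP[zx /ih h].
rewrite !big_cons derivM derivXsubC mul1r hornerD !hornerM h hornerXsubC.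
by field; rewrite subr_eq0.
Qed.

End RootPolynomial.

Section CircleProducts.
Variable R : realType.
Implicit Types (s : seq (R[i] * R)) (r : seq R[i]) (z w a : R[i]).

Definition lsum s z := \sum_(p <- s) (p.2%:C)%C * (z / (z - p.1)).

Fixpoint bpoly s : {poly R[i]} :=
  if s is p :: s' then
    ('X - p.1%:P) * bpoly s' + (p.2%:C)%C%:P * zpoly (unzip1 s')
  else 0.

(* Up to a monomial factor, [z |-> hpoly (L + L') s] is, on the unit circle,
   the combination [L' f + i f'] of the generalized trigonometric polynomial
   [f] with modulus [mprod s], divided by the product of the
   [|z - p.1| ^ (p.2 - 1)]. *)
Definition hpoly a s : {poly R[i]} := a *: zpoly (unzip1 s) - 'X * bpoly s.

Lemma bpoly_horner s z : z \notin unzip1 s ->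
  (bpoly s).[z] = (zpoly (unzip1 s)).[z] * \sum_(p <- s) (p.2%:C)%C / (z - p.1).
Proof.
elim: s => [|p s ih] /=; first by rewrite big_nil mulr0 horner0.
rewrite inE negb_or => /andP[zx /ih h].
rewrite hornerD !hornerM h hornerXsubC hornerC /zpoly !big_cons hornerM hornerXsubC.
by field; rewrite subr_eq0.
Qed.

Lemma bpoly_deriv s z : z \notin unzip1 s ->
  (bpoly s)^`().[z] = (zpoly (unzip1 s)).[z] *
   ((\sum_(p <- s) (z - p.1)^-1) * (\sum_(p <- s) (p.2%:C)%C / (z - p.1)) -
    \sum_(p <- s) (p.2%:C)%C / (z - p.1) ^+ 2).
Proof.
elim: s => [|p s ih] /=; first by rewrite !big_nil derivC horner0 mulr0 subr0 mulr0.
rewrite inE negb_or => /andP[zx zs].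
have h := ih zs; have hb := bpoly_horner zs; have hz := zpoly_deriv zs.
rewrite big_map in hz.
rewrite derivD !derivM derivXsubC derivC mul1r mul0r add0r !hornerD !hornerM h hb hz.
rewrite hornerXsubC hornerC /zpoly !big_cons hornerM hornerXsubC.
by field; rewrite subr_eq0.
Qed.

Lemma lsumE s z : lsum s z = z * \sum_(p <- s) (p.2%:C)%C / (z - p.1).
Proof. by rewrite /lsum mulr_sumr; apply: eq_bigr => p _; rewrite mulrCA. Qed.

Lemma hpoly_horner a s z : z \notin unzip1 s ->
  (hpoly a s).[z] = (zpoly (unzip1 s)).[z] * (a - lsum s z).
Proof.
move=> zs; rewrite /hpoly hornerD hornerN hornerZ hornerM hornerX bpoly_horner//.
by rewrite lsumE; ring.
Qed.

Lemma hpoly_logderiv a s z : z \notin unzip1 s -> (hpoly a s).[z] != 0 ->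
  z * (hpoly a s)^`().[z] / (hpoly a s).[z] =
  \sum_(p <- s) z / (z - p.1) -
  (\sum_(p <- s) (p.2%:C)%C * (z / (z - p.1) - (z / (z - p.1)) ^+ 2)) /
  (a - lsum s z).
Proof.
move=> zs; rewrite hpoly_horner// mulf_eq0 negb_or => /andP[Z0 A0].
rewrite {1}/hpoly derivB derivZ derivM derivX mul1r hornerD hornerN hornerZ.
rewrite hornerD hornerM hornerX bpoly_deriv// bpoly_horner// zpoly_deriv//.
have -> : \sum_(p <- s) (p.2%:C)%C * (z / (z - p.1) - (z / (z - p.1)) ^+ 2) =
  z * \sum_(p <- s) (p.2%:C)%C / (z - p.1) -
  z ^+ 2 * \sum_(p <- s) (p.2%:C)%C / (z - p.1) ^+ 2.
  rewrite !mulr_sumr -sumrB; apply: eq_bigr => p _.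
  by rewrite exprMn exprVn; ring.
have -> : \sum_(p <- s) z / (z - p.1) = z * \sum_(p <- s) (z - p.1)^-1.
  by rewrite mulr_sumr.
rewrite big_map.
have E : a - lsum s z = a - z * \sum_(p <- s) (p.2%:C)%C / (z - p.1) by rewrite lsumE.
move: A0; rewrite E => A0.
by field; rewrite Z0 A0.
Qed.

Lemma unit_circle_conj z : normc z = 1 -> (z^*)%C = z^-1.
Proof.
move=> z1; have z0 : z != 0 by rewrite -normc_eq0 z1 oner_eq0.
apply: (mulfI z0); rewrite divff//.
have /eqP := congr1 (fun x => x ^+ 2) z1; rewrite normc_sqr expr1n.
case: z {z1 z0} => x y /= /eqP h; apply/eqP; rewrite eq_complex/=.
by rewrite -h; apply/andP; split; apply/eqP; ring.
Qed.

Lemma cayley_circle z w : normc z = 1 -> normc w = 1 -> z != w ->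
  complex.Re (z / (z - w)) = 2^-1 /\
  z / (z - w) - (z / (z - w)) ^+ 2 = ((normc (z / (z - w)) ^+ 2)%:C)%C.
Proof.
move=> z1 w1 zw; set q := z / (z - w).
have z0 : z != 0 by rewrite -normc_eq0 z1 oner_eq0.
have w0 : w != 0 by rewrite -normc_eq0 w1 oner_eq0.
have zw0 : z - w != 0 by rewrite subr_eq0.
have wz0 : w - z != 0 by rewrite subr_eq0 eq_sym.
have qc : (q^*)%C = 1 - q.
  rewrite /q rmorphM/= conjc_inv rmorphB/= !unit_circle_conj//.
  by field; rewrite z0 w0 zw0 mulN1r wz0.
case: q qc => x y /eqP; rewrite eq_complex/= => /andP[/eqP h1 _].
split; first lra.
have -> : x = 2^-1 by lra.
rewrite normc_sqr/=; apply/eqP; rewrite eq_complex/=.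
by apply/andP; split; apply/eqP; field.
Qed.

Lemma powR_prod (I : Type) (t : seq I) (f : I -> R) c : (forall i, 0 <= f i) ->
  (\prod_(i <- t) f i) `^ c = \prod_(i <- t) f i `^ c.
Proof.
move=> f0; elim: t => [|i t ih]; first by rewrite !big_nil powR1.
by rewrite !big_cons powRM ?prodr_ge0// ih.
Qed.

Definition circle_list s := forall p, p \in s -> normc p.1 = 1.

Definition hlist (mu sg : R) s r : seq (R[i] * R) :=
  [seq (p.1, sg * (mu * p.2 - 1)) | p <- s] ++ [seq (x, sg) | x <- r].

Lemma mprod_roots (sg : R) r z :
  mprod [seq (x, sg) | x <- r] z = normc (zpoly r).[z] `^ sg.
Proof.
rewrite zpoly_horner normc_prod powR_prod => [|x]; last exact: normc_ge0.
by rewrite /mprod big_map.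
Qed.

Lemma mprod_hlist mu sg a s r z : z \notin unzip1 s ->
  hpoly a s = lead_coef (hpoly a s) *: zpoly r ->
  normc (lead_coef (hpoly a s)) `^ sg * mprod (hlist mu sg s r) z =
  (mprod s z `^ mu * normc (a - lsum s z)) `^ sg.
Proof.
move=> zs hr; rewrite mprod_cat mprod_roots.
have n0 := @normc_ge0 R.
rewrite mulrCA -powRM// -ComplexField.Normc.normcM -hornerZ -hr hpoly_horner//.
rewrite ComplexField.Normc.normcM !powRM ?powR_ge0// mulrA; congr (_ * _).
rewrite zpoly_horner normc_prod big_map /mprod big_map.
rewrite !powR_prod; do ?[by move=> p; exact: powR_ge0|by move=> p; exact: n0].
rewrite -big_split/=; apply: eq_big_seq => p ps.
have np : 0 < normc (z - p.1).
  rewrite normc_gt0 subr_eq0; apply: contra zs => /eqP ->.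
  by apply/mapP; exists p.
rewrite -!powRrM -powRD; last by rewrite (gt_eqF np) implybT.
by congr (_ `^ _); ring.
Qed.

Lemma hlist_sum mu sg a s r z : z \notin unzip1 s -> (hpoly a s).[z] != 0 ->
  hpoly a s = lead_coef (hpoly a s) *: zpoly r ->
  \sum_(p <- hlist mu sg s r) (p.2%:C)%C * (z / (z - p.1)) =
  (sg%:C)%C * ((mu%:C)%C * lsum s z -
    (\sum_(p <- s) (p.2%:C)%C * (z / (z - p.1) - (z / (z - p.1)) ^+ 2)) /
    (a - lsum s z)).
Proof.
move=> zs h0 hr.
have zr : z \notin r.
  apply: contra h0 => zr; rewrite hr hornerZ zpoly_horner.
  by rewrite (big_rem z)//= subrr mul0r mulr0.
have lc0 : lead_coef (hpoly a s) != 0.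
  by apply: contraNneq h0 => h; rewrite hr h scale0r horner0.
have rE : \sum_(x <- r) z / (z - x) =
    z * (hpoly a s)^`().[z] / (hpoly a s).[z].
  rewrite hr derivZ !hornerZ zpoly_deriv//.
  rewrite -mulr_sumr; field.
  by rewrite zpoly_neq0.
have {rE} := etrans rE (hpoly_logderiv zs h0).
rewrite /hlist big_cat !big_map/= => rE.
rewrite -mulr_sumr rE mulrBr mulrBr addrA; congr (_ - _).
rewrite /lsum !mulr_sumr -big_split/=; apply: eq_bigr => p _.
by rewrite !rmorphM rmorphB rmorphM/= rmorph1; ring.
Qed.

Lemma lsum_Re s z : circle_list s -> normc z = 1 -> z \notin unzip1 s ->
  complex.Re (lsum s z) = (\sum_(p <- s) p.2) / 2.
Proof.
rewrite /lsum; elim: s => [|p s ih] H z1; first by rewrite !big_nil mul0r.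
rewrite inE negb_or => /andP[zp zs].
rewrite !big_cons ReD ih// => [|q qs]; last by apply: H; rewrite inE qs orbT.
have [h _] := cayley_circle z1 (H _ (mem_head _ _)) zp.
by rewrite ReZ h mulrDl.
Qed.

Lemma lsum_curvature s z : circle_list s -> normc z = 1 -> z \notin unzip1 s ->
  exists k : R,
  \sum_(p <- s) (p.2%:C)%C * (z / (z - p.1) - (z / (z - p.1)) ^+ 2) = (k%:C)%C.
Proof.
elim: s => [|p s ih] H z1; first by exists 0; rewrite big_nil.
rewrite inE negb_or => /andP[zp zs].
have [//|k kE] := ih _ z1 zs; first by move=> q qs; apply: H; rewrite inE qs orbT.
have [_ h] := cayley_circle z1 (H _ (mem_head _ _)) zp.
rewrite big_cons kE h -rmorphM -rmorphD/=.
by exists (p.2 * normc (z / (z - p.1)) ^+ 2 + k).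
Qed.

Lemma critical_dichotomy (mu sg L L' : R) s r z :
  circle_list s -> normc z = 1 -> z \notin unzip1 s ->
  \sum_(p <- s) p.2 = 2 * L -> 0 < L' -> sg != 0 ->
  hpoly ((L + L')%:C)%C s = lead_coef (hpoly ((L + L')%:C)%C s) *: zpoly r ->
  0 < mprod (hlist mu sg s r) z ->
  (forall p, p \in hlist mu sg s r -> z != p.1) ->
  (forall w, normc w <= 1 ->
     mprod (hlist mu sg s r) w <= mprod (hlist mu sg s r) z) ->
  complex.Im (lsum s z) = 0 \/ 0 <= sg * (mu * (L - L')).
Proof.
move=> cs z1 zs sL L'0 sg0 hr m0 zh mx.
have pRe := lsum_Re cs z1 zs; rewrite sL mulrC mulKf// in pRe.
have [k kE] := lsum_curvature cs z1 zs.
have h0 : (hpoly ((L + L')%:C)%C s).[z] != 0.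
  rewrite hpoly_horner// mulf_neq0 ?zpoly_neq0// subr_eq0.
  by apply/eqP => /(congr1 (@complex.Re R)); rewrite pRe/=; lra.
have [] := mprod_boundary_max z1 zh m0 mx.
rewrite (hlist_sum _ _ zs h0 hr) kE ImZ ReZ.
set t := complex.Im (lsum s z).
have pE : lsum s z = (L +i* t)%C by apply/eqP; rewrite eq_complex/= pRe !eqxx.
have D0 : 0 < L' ^+ 2 + t ^+ 2 by rewrite ltr_pwDl ?exprn_gt0 ?sqr_ge0.
have -> : (k%:C)%C / (((L + L')%:C)%C - lsum s z) =
    ((k * L' / (L' ^+ 2 + t ^+ 2)) +i* (k * t / (L' ^+ 2 + t ^+ 2)))%C.
  rewrite pE; apply: (@mulIf _ (((L + L')%:C)%C - (L +i* t)%C)).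
    by rewrite -pE subr_eq0; apply/eqP => /(congr1 (@complex.Re R));
      rewrite pRe/=; lra.
  rewrite divfK; last first.
    by rewrite -pE subr_eq0; apply/eqP => /(congr1 (@complex.Re R));
      rewrite pRe/=; lra.
  by apply/eqP; rewrite eq_complex/=; apply/andP; split; apply/eqP; field; lra.
rewrite pE ImD ReD ImN ReN ImZ ReZ/= => /eqP.
rewrite mulf_eq0 (negbTE sg0)/= => /eqP h1 h2.
have [->|t0] := eqVneq t 0; first by left.
right; have kk : k = mu * (L' ^+ 2 + t ^+ 2).
  apply: (mulIf t0); have := congr1 ( *%R^~ (L' ^+ 2 + t ^+ 2)) h1.
  rewrite /= mul0r mulrBl divfK ?gt_eqF//; lra.
move: h2; rewrite kk; congr (is_true (_ <= _)).
by field; lra.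
Qed.

Lemma mprod_eq0 s p : p \in s -> p.2 != 0 -> mprod s p.1 = 0.
Proof.
move=> ps p0; rewrite /mprod (big_rem p)//= subrr ComplexField.Normc.normc0.
by rewrite powR0// mul0r.
Qed.

Lemma mprod_gt0 s z : z \notin unzip1 s -> 0 < mprod s z.
Proof.
rewrite /mprod; elim: s => [|p s ih]; first by rewrite big_nil.
rewrite inE negb_or => /andP[zp /ih h].
by rewrite big_cons mulr_gt0// powR_gt0// normc_gt0 subr_eq0.
Qed.

Lemma hlist_notin mu sg s r z : sg != 0 -> (forall p, p \in s -> mu * p.2 != 1) ->
  mprod (hlist mu sg s r) z != 0 ->
  z \notin unzip1 s /\ (forall p, p \in hlist mu sg s r -> z != p.1).
Proof.
move=> sg0 H m0.
have h p : p \in hlist mu sg s r -> z != p.1.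
  move=> ph; apply: contra m0 => /eqP ->; apply/eqP/mprod_eq0 => //.
  move: ph; rewrite mem_cat => /orP[] /mapP[q qs ->]//=.
  by rewrite mulf_neq0// subr_eq0 H.
split=> //; apply/negP => /mapP[p ps zp].
have/h : (p.1, sg * (mu * p.2 - 1)) \in hlist mu sg s r.
  by rewrite mem_cat; apply/orP; left; apply/mapP; exists p.
by rewrite zp eqxx.
Qed.

Lemma hpoly_root_list a s : exists r,
  hpoly a s = lead_coef (hpoly a s) *: zpoly r.
Proof.
have [r hr] := closed_field_poly_normal (hpoly a s : {poly [the closedFieldType of R[i]]}).
by exists r.
Qed.

Lemma critical_point_modulus (L L' : R) s z : circle_list s -> normc z = 1 ->
  z \notin unzip1 s -> \sum_(p <- s) p.2 = 2 * L -> 0 <= L' ->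
  complex.Im (lsum s z) = 0 -> normc (((L + L')%:C)%C - lsum s z) = L'.
Proof.
move=> cs z1 zs sL L'0 I0.
have -> : lsum s z = (L%:C)%C.
  apply/eqP; rewrite eq_complex/= I0 eqxx andbT (lsum_Re cs z1 zs) sL mulrC.
  by rewrite mulKf.
by rewrite -rmorphB/= addrAC subrr add0r normc_real ger0_norm.
Qed.

Lemma circle_bernstein_aux s (L L' M d : R) z : circle_list s ->
  (forall p, p \in s -> 1 <= p.2) -> \sum_(p <- s) p.2 = 2 * L ->
  (forall w, normc w = 1 -> mprod s w <= M) -> 0 < d -> L < L' -> 0 < L' ->
  normc z = 1 -> z \notin unzip1 s ->
  mprod s z `^ (1 + d) * normc (((L + L')%:C)%C - lsum s z) <= M `^ (1 + d) * L'.
Proof.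
move=> cs s1 sL sM d0 LL' L'0 z1 zs.
have [r hr] := hpoly_root_list ((L + L')%:C)%C s.
set mu := 1 + d; set s' := hlist mu 1 s r.
have mu1 p : p \in s -> 1 < mu * p.2 by move=> /s1; rewrite /mu; nra.
have reg : disc_regular s'.
  move=> p; rewrite mem_cat => /orP[] /mapP[q qs ->]/=; left => //.
  by have := mu1 q qs; lra.
have e1 : (1 : R) != 0 by rewrite oner_eq0.
have val w : w \notin unzip1 s -> normc (lead_coef (hpoly ((L + L')%:C)%C s)) *
    mprod s' w = mprod s w `^ mu * normc (((L + L')%:C)%C - lsum s w).
  move=> ws; have := mprod_hlist mu 1 ws hr.
  by rewrite !powRr1 ?mulr_ge0 ?powR_ge0 ?normc_ge0.
have [z0 z01 zm] := circle_max reg.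
rewrite -val// (le_trans (ler_wpM2l _ (zm z z1))) ?normc_ge0//.
have [->|m0] := eqVneq (mprod s' z0) 0.
  by rewrite mulr0 mulr_ge0 ?powR_ge0// ltW.
have [z0s z0h] : z0 \notin unzip1 s /\ forall p, p \in s' -> z0 != p.1.
  by apply: hlist_notin => // p /mu1; rewrite lt_neqAle eq_sym => /andP[].
have [||I0|] := critical_dichotomy cs z01 z0s sL L'0 e1 hr _ z0h.
- by rewrite lt_def m0 mprod_ge0.
- by apply: mprod_max_principle reg _.
- rewrite val// (critical_point_modulus cs z01 z0s sL (ltW L'0) I0) ler_wpM2r ?(ltW L'0)//.
  by rewrite ge0_ler_powR ?nnegrE ?mprod_ge0 ?sM// ?(le_trans (mprod_ge0 s z) (sM _ z1))//
    /mu; lra.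
- by rewrite mul1r pmulr_rge0 /mu; lra.
Qed.

(* The Bernstein-Szego inequality [f' ^ 2 + L ^ 2 f ^ 2 <= L ^ 2 max f ^ 2] for a
   generalized trigonometric polynomial [f] of degree [L] whose zeros are real
   with multiplicities at least 1. *)
Lemma circle_bernstein s (L M : R) z : circle_list s ->
  (forall p, p \in s -> 1 <= p.2) -> \sum_(p <- s) p.2 = 2 * L -> 0 < L ->
  (forall w, normc w = 1 -> mprod s w <= M) ->
  normc z = 1 -> z \notin unzip1 s ->
  mprod s z * normc (((2 * L)%:C)%C - lsum s z) <= L * M.
Proof.
move=> cs s1 sL L0 sM z1 zs.
have x0 := mprod_gt0 zs; have xM := sM _ z1; have M0 := lt_le_trans x0 xM.
have rho : 1 <= M / mprod s z by rewrite ler_pdivlMr// mul1r.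
have lr : 0 <= ln (M / mprod s z) by rewrite ln_ge0.
have lrL : 0 < ln (M / mprod s z) + L^-1 by rewrite ltr_wpDl// invr_gt0.
apply: le_mul_expR_le => e e0.
pose d := e / (ln (M / mprod s z) + L^-1).
have d0 : 0 < d by rewrite divr_gt0.
have pRe := lsum_Re cs z1 zs; rewrite sL mulrC mulKf// in pRe.
have Ld : L < L + d by rewrite ltrDl.
have Ld0 : 0 < L + d by rewrite addr_gt0.
have h := circle_bernstein_aux cs s1 sL sM d0 Ld Ld0 z1 zs.
have nn : normc (((2 * L)%:C)%C - lsum s z) <=
    normc (((L + (L + d))%:C)%C - lsum s z).
  rewrite -(@ler_pXn2r _ 2) ?nnegrE ?normc_ge0// !normc_sqr !ReD !ImD !ReN !ImN pRe/=.
  have -> : 2 * L - L = L by ring.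
  have -> : L + (L + d) - L = L + d by ring.
  by rewrite lerD2r ler_pXn2r ?nnegrE ?ltW.
have xd : 0 < mprod s z `^ d by rewrite powR_gt0.
rewrite -(ler_pM2l xd) mulrA.
have -> : mprod s z `^ d * mprod s z = mprod s z `^ (1 + d).
  by rewrite addrC powRD ?powRr1 ?(ltW x0)// (gt_eqF x0) implybT.
apply: (le_trans (ler_wpM2l (powR_ge0 _ _) nn)); apply: (le_trans h).
have MM : M `^ (1 + d) = M * mprod s z `^ d * expR (d * ln (M / mprod s z)).
  rewrite powRD; last by rewrite (gt_eqF M0) implybT.
  rewrite powRr1 ?ltW// -mulrA; congr (_ * _).
  rewrite /powR !gt_eqF// -expRD; congr expR.
  by rewrite ln_div ?posrE//; ring.
have LL : L + d <= L * expR (d / L).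
  have := expR_ge1Dx (d / L); rewrite -(ler_pM2l L0) mulrDr mulr1.
  by rewrite (mulrC d) mulVKf// gt_eqF.
have -> : e = d * ln (M / mprod s z) + d / L.
  by rewrite -mulrDr /d divfK// gt_eqF.
rewrite expRD MM.
have := ler_wpM2l (ltW M0) (ler_wpM2l (ltW xd) (ler_wpM2l
  (expR_ge0 (d * ln (M / mprod s z))) LL)).
by congr (is_true (_ <= _)); ring.
Qed.

Lemma cayley_disc z w : normc z <= 1 -> normc w = 1 -> z != w ->
  complex.Re (z / (z - w)) <= 2^-1.
Proof.
move=> z1 w1 zw; have zw0 : 0 < normc (z - w) ^+ 2.
  by rewrite exprn_gt0// normc_gt0 subr_eq0.
have {}z1 : normc z ^+ 2 <= 1 by rewrite exprn_ile1 ?normc_ge0.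
have {}w1 : normc w ^+ 2 = 1 by rewrite w1 expr1n.
rewrite -(ler_pM2r zw0).
have -> : complex.Re (z / (z - w)) * normc (z - w) ^+ 2 =
    complex.Re (z * ((z - w)^*)%C).
  rewrite normc_sqr in zw0 *.
  case: z w zw z1 w1 zw0 => [a b] [c d] /= _ _ _ h.
  by field; lra.
rewrite !normc_sqr in z1 w1 *.
case: z w zw z1 w1 zw0 => [a b] [c d] /= _ h1 h2 _; nra.
Qed.

Lemma lsum_disc s z : circle_list s -> (forall p, p \in s -> 0 <= p.2) ->
  normc z <= 1 -> z \notin unzip1 s ->
  complex.Re (lsum s z) <= (\sum_(p <- s) p.2) / 2.
Proof.
rewrite /lsum; elim: s => [|p s ih] H s0 z1; first by rewrite !big_nil mul0r.
rewrite inE negb_or => /andP[zp zs].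
rewrite !big_cons ReD mulrDl lerD//.
  by rewrite ReZ ler_wpM2l ?cayley_disc ?s0 ?H ?mem_head.
by apply: ih => // q qs; [apply: H|apply: s0]; rewrite inE qs orbT.
Qed.

Lemma bpoly_zero_neq0 s x : uniq (unzip1 s) -> x \in unzip1 s ->
  (forall p, p \in s -> p.2 != 0) -> (bpoly s).[x] != 0.
Proof.
elim: s => [//|p s ih] /= /andP[ps us]; rewrite inE => xs s0.
rewrite hornerD !hornerM hornerXsubC hornerC.
have [xp|xp] := eqVneq x p.1.
  rewrite xp subrr mul0r add0r mulf_neq0 ?zpoly_neq0//.
  by apply/eqP => -[]; apply/eqP; exact: s0 (mem_head _ _).
move: xs; rewrite (negbTE xp)/= => xs.
have -> : (zpoly (unzip1 s)).[x] = 0.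
  by rewrite zpoly_horner (big_rem x)//= subrr mul0r.
rewrite mulr0 addr0 mulf_neq0 ?subr_eq0// ih// => q qs.
by apply: s0; rewrite inE qs orbT.
Qed.

Lemma hpoly_disc_neq0 s (L L' : R) z : circle_list s -> uniq (unzip1 s) ->
  (forall p, p \in s -> 0 < p.2) -> \sum_(p <- s) p.2 = 2 * L -> 0 < L' ->
  normc z <= 1 -> (hpoly ((L + L')%:C)%C s).[z] != 0.
Proof.
move=> cs us s0 sL L'0 z1.
have [zs|zs] := boolP (z \in unzip1 s); last first.
  rewrite hpoly_horner// mulf_neq0 ?zpoly_neq0// subr_eq0.
  apply/eqP => /(congr1 (@complex.Re R))/=.
  have := @lsum_disc s z cs (fun p ps => ltW (s0 p ps)) z1 zs.
  by rewrite sL mulrC mulKf//; lra.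
rewrite /hpoly hornerD hornerN hornerZ hornerM hornerX.
have -> : (zpoly (unzip1 s)).[z] = 0.
  by rewrite zpoly_horner (big_rem z)//= subrr mul0r.
rewrite mulr0 add0r oppr_eq0 mulf_neq0//; last first.
  by apply: bpoly_zero_neq0 => // p /s0; rewrite lt_def => /andP[].
have /mapP[p ps ->] := zs.
by rewrite -normc_eq0 cs// oner_eq0.
Qed.

Lemma circle_min_critical_aux s (L L' m d : R) : circle_list s ->
  uniq (unzip1 s) -> (forall p, p \in s -> 0 < p.2 <= 1) ->
  \sum_(p <- s) p.2 = 2 * L -> 0 <= m ->
  (forall z, normc z = 1 -> z \notin unzip1 s -> complex.Im (lsum s z) = 0 ->
    m <= mprod s z) ->
  0 < d < 1 -> 0 < L' < L -> m `^ (1 - d) * L' <= L + L'.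
Proof.
move=> cs us s1 sL m0 sm /andP[d0 d1] /andP[L'0 LL'].
have s0 p : p \in s -> 0 < p.2 by move=> /s1/andP[].
have nz := @hpoly_disc_neq0 s L L' _ cs us s0 sL L'0.
have [r hr] := hpoly_root_list ((L + L')%:C)%C s.
set mu := 1 - d; set s' := hlist mu (-1) s r.
have mu1 p : p \in s -> mu * p.2 < 1 by move=> /s1/andP[]; rewrite /mu; nra.
have reg : disc_regular s'.
  move=> p; rewrite mem_cat => /orP[] /mapP[q qs ->]/=.
    by left; have := mu1 q qs; lra.
  right; rewrite ltNge; apply/negP => /nz/negP; apply.
  by rewrite hr hornerZ zpoly_horner (big_rem q)//= subrr mul0r mulr0.
have lc0 : lead_coef (hpoly ((L + L')%:C)%C s) != 0.
  have nz0 := nz 0; rewrite ComplexField.Normc.normc0 ler01 in nz0.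
  by apply: contra (nz0 isT) => /eqP h; rewrite hr h scale0r horner0.
have lcp : 0 < normc (lead_coef (hpoly ((L + L')%:C)%C s)) by rewrite normc_gt0.
have [z0 z01 zm] := circle_max reg.
have mx := mprod_max_principle reg zm.
have at0 : normc (lead_coef (hpoly ((L + L')%:C)%C s)) `^ (-1) * mprod s' 0 =
    (L + L') `^ (-1).
  rewrite mprod_cat mprod_roots; set A := mprod _ _.
  have -> : A = 1.
    rewrite /A /mprod big_map; apply: big1_seq => p /andP[_ ps] /=.
    by rewrite sub0r (@normcN R) cs// powR1.
  rewrite mul1r -powRM ?normc_ge0// -ComplexField.Normc.normcM -hornerZ -hr.
  rewrite /hpoly hornerD hornerN hornerZ hornerM hornerX mul0r subr0.
  rewrite ComplexField.Normc.normcM normc_real ger0_norm; last lra.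
  rewrite zpoly_horner normc_prod big_map big1_seq ?mulr1// => p /andP[_ ps].
  by rewrite sub0r (@normcN R) cs.
have a0 : 0 < L + L' by lra.
have m00 : 0 < mprod s' 0.
  by rewrite -(pmulr_rgt0 _ (powR_gt0 (-1) lcp)) at0 powR_gt0.
have z00 : mprod s' 0 <= mprod s' z0.
  by apply: mx; rewrite ComplexField.Normc.normc0.
have mz0 := lt_le_trans m00 z00.
have e1 : (-1 : R) != 0 by rewrite oppr_eq0 oner_eq0.
have [z0s z0h] : z0 \notin unzip1 s /\ forall p, p \in s' -> z0 != p.1.
  apply: hlist_notin => // [p /mu1|]; last by rewrite gt_eqF.
  by rewrite lt_neqAle => /andP[].
have [//|I0|] := critical_dichotomy cs z01 z0s sL L'0 e1 hr mz0 z0h; last first.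
  by rewrite mulN1r oppr_ge0 leNgt mulr_gt0// /mu; lra.
have := mprod_hlist mu (-1) z0s hr.
rewrite (critical_point_modulus cs z01 z0s sL (ltW L'0) I0) => val.
have := ler_wpM2l (powR_ge0 (normc (lead_coef (hpoly ((L + L')%:C)%C s))) (-1)) z00.
have xL : 0 < mprod s z0 `^ mu * L' by rewrite mulr_gt0 ?powR_gt0 ?mprod_gt0.
rewrite at0 val !powR_inv1 ?(ltW a0) ?(ltW xL)//.
rewrite lef_pV2 ?posrE// => h.
apply: le_trans h; rewrite ler_wpM2r ?(ltW L'0)// ge0_ler_powR ?nnegrE ?mprod_ge0 ?sm//.
by rewrite /mu; lra.
Qed.

(* The mirror image of [circle_bernstein] for multiplicities at most 1: now the
   minimum principle applies, and at the centre it bounds the smallest critical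
   value. *)
Lemma circle_min_critical s (L m : R) : circle_list s ->
  uniq (unzip1 s) -> (forall p, p \in s -> 0 < p.2 <= 1) ->
  \sum_(p <- s) p.2 = 2 * L -> 0 < L ->
  (forall z, normc z = 1 -> z \notin unzip1 s -> complex.Im (lsum s z) = 0 ->
    m <= mprod s z) -> m <= 2.
Proof.
move=> cs us s1 sL L0 sm; rewrite leNgt; apply/negP => m2.
suff : m <= 2 by rewrite leNgt m2.
have lm : 0 < ln m by rewrite ln_gt0//; lra.
apply: le_mul_expR_le => e e0.
pose d := Num.min 2^-1 (e / (2 * ln m)).
pose h := Num.min 2^-1 (e / 4).
have d0 : 0 < d by rewrite /d lt_min; apply/andP; split; rewrite ?invr_gt0 ?divr_gt0 ?mulr_gt0.
have h0 : 0 < h by rewrite /h lt_min; apply/andP; split; rewrite ?invr_gt0 ?divr_gt0.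
have : d <= d by [].
rewrite {2}/d le_min => /andP[d2 de].
have : h <= h by [].
rewrite {2}/h le_min => /andP[h2 he].
have d1 : 0 < d < 1 by rewrite d0; lra.
have hL : 0 < L * (1 - h) < L by nra.
have m0 : 0 <= m by lra.
have := circle_min_critical_aux cs us s1 sL m0 sm d1 hL.
have -> : L + L * (1 - h) = (2 - h) * L by ring.
rewrite (mulrC L) mulrA ler_pM2r// => H.
have mE : m = m `^ (1 - d) * expR (d * ln m).
  by rewrite /powR gt_eqF -?expRD; [rewrite -[LHS]lnK ?posrE; [congr expR; ring|lra]|lra].
have dl : d * ln m <= e / 2.
  apply: (le_trans (ler_wpM2r (ltW lm) de)).
  by rewrite invfM mulrA divfK// gt_eqF.
have e1 := expR_ge1Dx (e / 2).
have m1 : m `^ (1 - d) <= 2 * expR (e / 2).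
  rewrite -(ler_pM2r (_ : 0 < 1 - h)); last lra.
  apply: (le_trans H); nra.
rewrite mE.
apply: (@le_trans _ _ (2 * expR (e / 2) * expR (e / 2))).
  by rewrite ler_pM ?powR_ge0 ?expR_ge0// ler_expR.
by rewrite -mulrA -expRD ler_pM2l// ler_expR; lra.
Qed.

End CircleProducts.

(** * Minimal weighted norms *)

Section Widom.
Variable R : realType.
Variables ra rb : R.
Hypotheses (ra0 : 0 <= ra) (rb0 : 0 <= rb).

Lemma jacobi_weight_ge0 (x : R) : 0 <= jacobi_weight ra rb x.
Proof. by rewrite mulr_ge0 ?powR_ge0. Qed.

Lemma jacobi_weight_le (x : R) : -1 <= x <= 1 ->
  jacobi_weight ra rb x <= 2 `^ ra * 2 `^ rb.
Proof.
move=> /andP[x1 x2]; rewrite ler_pM ?powR_ge0//.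
  by rewrite ge0_ler_powR ?nnegrE//; lra.
by rewrite ge0_ler_powR ?nnegrE//; lra.
Qed.

Definition weighted_values (n : nat) (a : 'I_n -> R[i]) : set R :=
  [set jacobi_weight ra rb x * normc (\prod_(k < n) ((x%:C)%C - a k))
      | x in `[-1, 1]].

Lemma weighted_values_neq0 n (a : 'I_n -> R[i]) : weighted_values a !=set0.
Proof. by eexists; exists 0 => //=; rewrite in_itv/= lerN10 ler01. Qed.

Lemma weighted_values_bounded n (a : 'I_n -> R[i]) : has_ubound (weighted_values a).
Proof.
exists (2 `^ ra * 2 `^ rb * \prod_(k < n) (1 + normc (a k))) => _ [x /= x1 <-].
rewrite in_itv/= in x1.
rewrite ler_pM ?jacobi_weight_ge0 ?normc_ge0 ?jacobi_weight_le//.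
rewrite normc_prod; apply: ler_prod => k _; rewrite normc_ge0/=.
rewrite (le_trans (normc_le_add _ _))// (@normcN R) normc_real lerD2r ler_norml.
by [].
Qed.

Lemma weighted_max_ge n (a : 'I_n -> R[i]) (x : R) : -1 <= x <= 1 ->
  jacobi_weight ra rb x * normc (\prod_(k < n) ((x%:C)%C - a k))
  <= weighted_max ra rb a.
Proof.
move=> x1; apply: ub_le_sup; first exact: weighted_values_bounded.
by exists x => //=; rewrite in_itv.
Qed.

Lemma weighted_max_le n (a : 'I_n -> R[i]) (K : R) :
  (forall x : R, -1 <= x <= 1 ->
     jacobi_weight ra rb x * normc (\prod_(k < n) ((x%:C)%C - a k)) <= K) ->
  weighted_max ra rb a <= K.
Proof.
move=> H; apply: ge_sup; first exact: weighted_values_neq0.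
by move=> _ [x /= x1 <-]; apply: H; rewrite in_itv in x1.
Qed.

Lemma weighted_max_ge0 n (a : 'I_n -> R[i]) : 0 <= weighted_max ra rb a.
Proof.
have x1 : -1 <= (0 : R) <= 1 by rewrite lerN10 ler01.
by apply: le_trans (weighted_max_ge a x1); rewrite mulr_ge0 ?jacobi_weight_ge0 ?normc_ge0.
Qed.

Definition min_norm n := inf (range (@weighted_max R ra rb n)).

Lemma widomE n : widom ra rb n = 2 ^+ n * min_norm n.
Proof. by []. Qed.

Lemma min_norm_le_weighted_max n (a : 'I_n -> R[i]) :
  min_norm n <= weighted_max ra rb a.
Proof.
apply: ge_inf; last by exists a.
by exists 0 => _ [b _ <-]; exact: weighted_max_ge0.
Qed.

Lemma monic_real_nodes n (p : {poly R}) : p \is monic -> size p = n.+1 ->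
  exists a : 'I_n -> R[i], forall x : R,
    normc (\prod_(k < n) ((x%:C)%C - a k)) = `|p.[x]|.
Proof.
move=> pm ps; pose q := map_poly (real_complex R) p.
have qm : lead_coef q = 1 by rewrite lead_coef_map (monicP pm) rmorph1.
have [r] := closed_field_poly_normal (q : {poly [the closedFieldType of R[i]]}).
rewrite [lead_coef _]qm scale1r => hr.
have sr : size r = n.
  have := congr1 (size \o polyseq) hr.
  by rewrite /= size_prod_XsubC size_map_poly ps => -[].
exists (fun k => r`_k) => x.
rewrite -normc_real -[RHS]/(normc (p.[x]%:C)%C).
have -> : (p.[x]%:C)%C = q.[(x%:C)%C] by rewrite horner_map.
rewrite hr horner_prod (big_nth 0) sr big_mkord; congr normc.
by apply: eq_bigr => k _; rewrite hornerXsubC.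
Qed.

Lemma min_norm_le n (p : {poly R}) (K : R) : p \is monic -> size p = n.+1 ->
  (forall x : R, -1 <= x <= 1 -> jacobi_weight ra rb x * `|p.[x]| <= K) ->
  min_norm n <= K.
Proof.
move=> pm ps H; have [a aE] := monic_real_nodes pm ps.
apply: le_trans (min_norm_le_weighted_max a) _.
by apply: weighted_max_le => x x1; rewrite aE H.
Qed.

Definition clamp (x : R) : R := Num.max (-1) (Num.min 1 x).

Lemma clamp_itv x : -1 <= clamp x <= 1.
Proof.
have n11 : (-1 : R) <= 1 by lra.
by rewrite /clamp le_max lexx/= ge_max n11/= ge_min lexx.
Qed.

Lemma clamp_dist (x y : R) : -1 <= x <= 1 -> `|x - clamp y| <= `|x - y|.
Proof.
move=> /andP[x1 x2]; rewrite /clamp.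
have [y1|y1] := leP 1 y.
  by rewrite max_r; [rewrite !ler0_norm; lra|lra].
have [y2|y2] := leP y (-1); last by [].
by rewrite !ger0_norm; lra.
Qed.

Lemma min_norm_nodes n (v : R) : min_norm n < v ->
  exists t : 'I_n -> R, (forall k, -1 <= t k <= 1) /\
  (forall x : R, -1 <= x <= 1 ->
    jacobi_weight ra rb x * `|\prod_(k < n) (x - t k)| <= v).
Proof.
move=> /inf_lt[|_ [a _ <-] av].
  by exists (weighted_max ra rb (fun _ : 'I_n => 0)); exists (fun=> 0).
exists (fun k => clamp (complex.Re (a k))); split=> [k|x x1]; first exact: clamp_itv.
apply: le_trans (ltW av); apply: le_trans (weighted_max_ge a x1).
rewrite ler_wpM2l ?jacobi_weight_ge0// normr_prod normc_prod.
apply: ler_prod => k _; rewrite normr_ge0/=.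
apply: le_trans (clamp_dist _ x1) _.
by apply: le_trans (normc_ge_Re _); rewrite ReD ReN.
Qed.

Lemma le_min_norm n (K : R) :
  (forall t : 'I_n -> R, (forall k, -1 <= t k <= 1) ->
    exists2 x : R, -1 <= x <= 1 &
      K <= jacobi_weight ra rb x * `|\prod_(k < n) (x - t k)|) ->
  K <= min_norm n.
Proof.
move=> H; rewrite leNgt; apply/negP => /midf_lt[h1 h2].
have [t [t1 tv]] := min_norm_nodes h1.
have [x x1] := H t t1; rewrite leNgt => /negP; apply.
by apply: le_lt_trans (tv x x1) h2.
Qed.

End Widom.

(** * From the interval to the circle *)

Section JacobiCircle.
Variable R : realType.
Variables ra rb : R.
Hypotheses (ra0 : 0 <= ra) (rb0 : 0 <= rb).
Implicit Types (t : seq R) (x y : R) (z : R[i]).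

Definition circle_pt x : R[i] := (x +i* Num.sqrt (1 - x ^+ 2))%C.

Lemma sqr_le1 x : -1 <= x <= 1 -> 0 <= 1 - x ^+ 2.
Proof. by move=> /andP[x1 x2]; nra. Qed.

Lemma circle_pt_unit x : -1 <= x <= 1 -> normc (circle_pt x) = 1.
Proof.
move=> x1; rewrite /ComplexField.Normc.normc/= sqr_sqrtr ?sqr_le1//.
by rewrite addrC subrK sqrtr1.
Qed.

Lemma unit_sqr z : normc z = 1 -> complex.Re z ^+ 2 + complex.Im z ^+ 2 = 1.
Proof. by move=> z1; rewrite -normc_sqr z1 expr1n. Qed.

Lemma unit_Re_itv z : normc z = 1 -> -1 <= complex.Re z <= 1.
Proof. by move=> z1; rewrite -ler_norml -z1 normc_ge_Re. Qed.

Definition end_list : seq (R[i] * R) :=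
  (if ra == 0 then [::] else [:: (1, 2 * ra)]) ++
  (if rb == 0 then [::] else [:: (-1, 2 * rb)]).

Definition node_list t : seq (R[i] * R) :=
  [seq (circle_pt x, 1) | x <- t] ++ [seq (((circle_pt x)^*)%C, 1) | x <- t].

Definition jacobi_list t := end_list ++ node_list t.

Lemma jacobi_list_sum t :
  \sum_(p <- jacobi_list t) p.2 = 2 * ((size t)%:R + ra + rb).
Proof.
have E (u : R) (x : R[i]) :
    \sum_(p <- if u == 0 then [::] else [:: (x, 2 * u)]) p.2 = 2 * u.
  by case: eqP => [->|_]; rewrite ?big_nil ?mulr0// big_seq1.
rewrite !big_cat/= !E !big_map big_const_seq count_predT iter_addr_0.
by ring.
Qed.

Lemma mem_jacobi_list t p : p \in jacobi_list t ->
  [\/ p = (1, 2 * ra) /\ ra != 0, p = (-1, 2 * rb) /\ rb != 0 |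
      exists2 x, x \in t & p = (circle_pt x, 1) \/ p = (((circle_pt x)^*)%C, 1)].
Proof.
rewrite !mem_cat => /orP[/orP[]|/orP[]].
- by case: ifPn => // h; rewrite inE => /eqP ->; constructor 1.
- by case: ifPn => // h; rewrite inE => /eqP ->; constructor 2.
- by move=> /mapP[x xt ->]; constructor 3; exists x => //; left.
- by move=> /mapP[x xt ->]; constructor 3; exists x => //; right.
Qed.

Lemma jacobi_list_circle t : (forall x, x \in t -> -1 <= x <= 1) ->
  circle_list (jacobi_list t).
Proof.
move=> t1 p /mem_jacobi_list[[-> _]|[-> _]|[x xt [->|->]]]/=.
- exact: ComplexField.Normc.normc1.
- by rewrite (@normcN R) ComplexField.Normc.normc1.
- by rewrite circle_pt_unit ?t1.
- by rewrite (normc_conj (circle_pt x)) circle_pt_unit ?t1.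
Qed.

Lemma jacobi_list_ends t z : z \notin unzip1 (jacobi_list t) ->
  [/\ ra != 0 -> z != 1, rb != 0 -> z != -1 &
      forall x, x \in t -> z != circle_pt x /\ z != ((circle_pt x)^*)%C].
Proof.
rewrite /unzip1 !map_cat !mem_cat !negb_or.
move=> /andP[/andP[z1 zm1] /andP[zc zcc]]; split.
- by move=> h; move: z1; rewrite (negbTE h)/= inE.
- by move=> h; move: zm1; rewrite (negbTE h)/= inE.
move=> x xt; split; [apply: contra zc|apply: contra zcc] => /eqP ->.
  by rewrite -map_comp; apply/mapP; exists x.
by rewrite -map_comp; apply/mapP; exists x.
Qed.

Lemma conj_pair_factor z x : normc z = 1 -> -1 <= x <= 1 ->
  (z - circle_pt x) * (z - ((circle_pt x)^*)%C) = z * ((2 * (complex.Re z - x))%:C)%C.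
Proof.
move=> /unit_sqr zz x1; have ss := sqr_sqrtr (sqr_le1 x1).
rewrite /circle_pt; set s := Num.sqrt _ in ss *.
case: z zz => a b /= zz; apply/eqP; rewrite eq_complex/=.
apply/andP; split; apply/eqP; last by ring.
have -> : (a - x) * (a - x) - (b - s) * (b - - s) =
  a ^+ 2 - 2 * a * x + x ^+ 2 - b ^+ 2 + s ^+ 2 by ring.
have -> : b ^+ 2 = 1 - a ^+ 2 by rewrite -zz; ring.
rewrite ss; ring.
Qed.

Lemma normc_sub1_powR z (c : R) : normc z = 1 ->
  normc (z - 1) `^ (2 * c) = (2 * (1 - complex.Re z)) `^ c.
Proof.
move=> z1; rewrite powRrM powR_mulrn ?normc_ge0//; congr (_ `^ _).
by have := unit_sqr z1; rewrite normc_sqr; case: (z) => a b /=; lra.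
Qed.

Lemma normc_add1_powR z (c : R) : normc z = 1 ->
  normc (z - -1) `^ (2 * c) = (2 * (1 + complex.Re z)) `^ c.
Proof.
move=> z1; rewrite powRrM powR_mulrn ?normc_ge0//; congr (_ `^ _).
by have := unit_sqr z1; rewrite normc_sqr; case: (z) => a b /=; lra.
Qed.

Lemma mprod_end_list z : normc z = 1 ->
  mprod end_list z = 2 `^ (ra + rb) * jacobi_weight ra rb (complex.Re z).
Proof.
move=> z1; have /andP[x1 x2] := unit_Re_itv z1.
have E (x : R[i]) (u : R) : mprod (if u == 0 then [::] else [:: (x, 2 * u)]) z =
    normc (z - x) `^ (2 * u).
  by case: eqP => [->|_]; rewrite ?mprod_cons mprod_nil ?mulr1// mulr0 powRr0.
rewrite mprod_cat !E normc_sub1_powR// normc_add1_powR// !powRM; try lra.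
rewrite powRD /jacobi_weight; last by rewrite pnatr_eq0 implybT.
by ring.
Qed.

Lemma mprod_node_list t z : normc z = 1 -> (forall x, x \in t -> -1 <= x <= 1) ->
  mprod (node_list t) z =
  2 ^+ size t * `|\prod_(x <- t) (complex.Re z - x)|.
Proof.
move=> z1; rewrite mprod_cat /mprod !big_map -big_split/=.
elim: t => [|x t ih] t1; first by rewrite !big_nil normr1 mulr1.
rewrite !big_cons ih => [|y yt]; last by apply: t1; rewrite inE yt orbT.
rewrite !powRr1 ?normc_ge0// -ComplexField.Normc.normcM conj_pair_factor//; last first.
  by rewrite t1 ?mem_head.
rewrite ComplexField.Normc.normcM z1 normc_real !normrM ger0_norm//= exprS.
by ring.
Qed.

Lemma mprod_jacobi_list t z : normc z = 1 -> (forall x, x \in t -> -1 <= x <= 1) ->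
  mprod (jacobi_list t) z = 2 `^ (ra + rb) * 2 ^+ size t *
   (jacobi_weight ra rb (complex.Re z) * `|\prod_(x <- t) (complex.Re z - x)|).
Proof.
move=> z1 t1; rewrite mprod_cat mprod_end_list// mprod_node_list//.
by ring.
Qed.

Definition log_deriv t x : R :=
  - (ra / (1 - x)) + rb / (1 + x) + \sum_(y <- t) (x - y)^-1.

Lemma Im_sub1_inv z : normc z = 1 -> z != 1 ->
  complex.Im (z / (z - 1)) = - (complex.Im z / (2 * (1 - complex.Re z))).
Proof.
move=> z1 zn1.
have n1 : 1 - complex.Re z != 0.
  apply: contra zn1; have := unit_sqr z1; case: (z) => a b /= h /eqP a1.
  by rewrite eq_complex/=; apply/andP; split; apply/eqP; nra.
suff -> : z / (z - 1) = (2^-1 +i* - (complex.Im z / (2 * (1 - complex.Re z))))%C by [].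
apply: (mulIf (_ : z - 1 != 0)); first by rewrite subr_eq0.
rewrite divfK ?subr_eq0//; have := unit_sqr z1.
case: (z) n1 => a b /= n1 h; apply/eqP; rewrite eq_complex/=.
have hb : b * b = (1 - a) * (1 + a) by lra.
apply/andP; split; apply/eqP; last by field.
have -> : 2^-1 * (a - 1) - - (b / (2 * (1 - a))) * (b - 0) =
  2^-1 * (a - 1) + (b * b) / (2 * (1 - a)) by field.
by rewrite hb; field.
Qed.

Lemma Im_add1_inv z : normc z = 1 -> z != -1 ->
  complex.Im (z / (z - -1)) = complex.Im z / (2 * (1 + complex.Re z)).
Proof.
move=> z1 zn1.
have -> : z / (z - -1) = (- z) / (- z - 1).
  have -> : - z - 1 = - (z - -1) by ring.
  by rewrite invrN mulrNN.
rewrite Im_sub1_inv ?(@normcN R)//; last by rewrite eqr_oppLR.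
by rewrite ImN ReN opprK mulNr opprK.
Qed.

Lemma Im_node_pair z x : normc z = 1 -> -1 <= x <= 1 ->
  z != circle_pt x -> z != ((circle_pt x)^*)%C ->
  complex.Im (z / (z - circle_pt x) + z / (z - ((circle_pt x)^*)%C)) =
  complex.Im z / (complex.Re z - x).
Proof.
move=> z1 x1 zx zxc.
have h1 : z - circle_pt x != 0 by rewrite subr_eq0.
have h2 : z - ((circle_pt x)^*)%C != 0 by rewrite subr_eq0.
have E := conj_pair_factor z1 x1.
have := mulf_neq0 h1 h2; rewrite E mulf_eq0 negb_or => /andP[z0 c0].
have xx0 : complex.Re z - x != 0.
  by apply: contra c0 => /eqP ->; rewrite mulr0.
have cc0 : (((complex.Re z - x)%:C)%C : R[i]) != 0.
  by apply: contra xx0 => /eqP[->].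
have -> : z / (z - circle_pt x) + z / (z - ((circle_pt x)^*)%C) =
   (((complex.Re z - x)^-1)%:C)%C * (z - (x%:C)%C).
  have -> : z / (z - circle_pt x) + z / (z - ((circle_pt x)^*)%C) =
     z * (2 * z - (circle_pt x + ((circle_pt x)^*)%C)) /
     ((z - circle_pt x) * (z - ((circle_pt x)^*)%C)).
    by field; rewrite h2 h1.
  rewrite E addcJ/= fmorphV/= rmorphM/=.
  have -> : ((2%:C)%C : R[i]) = 2 by rewrite rmorph_nat.
  by move: ((complex.Re z - x)%:C)%C cc0 => c cc0; field; rewrite z0 cc0.
by rewrite ImZ ImD ImN/= subr0 mulrC.
Qed.

Lemma Im_lsum_jacobi t z : normc z = 1 -> (forall x, x \in t -> -1 <= x <= 1) ->
  z \notin unzip1 (jacobi_list t) ->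
  complex.Im (lsum (jacobi_list t) z) = complex.Im z * log_deriv t (complex.Re z).
Proof.
move=> z1 t1 /jacobi_list_ends[e1 em et].
have Im_sum (I : Type) (s : seq I) (f : I -> R[i]) :
    complex.Im (\sum_(i <- s) f i) = \sum_(i <- s) complex.Im (f i).
  by apply: (big_morph _ (@ImD R)).
rewrite /lsum !big_cat/= !ImD.
have E1 : complex.Im (\sum_(p <- if ra == 0 then [::] else [:: (1, 2 * ra)])
     (p.2%:C)%C * (z / (z - p.1))) = complex.Im z * - (ra / (1 - complex.Re z)).
  case: eqP => [->|/eqP h]; first by rewrite big_nil mul0r oppr0 mulr0.
  rewrite big_seq1/= ImZ Im_sub1_inv ?e1//.
  by rewrite invfM; move: ((1 - complex.Re z)^-1) => u; field.
have E2 : complex.Im (\sum_(p <- if rb == 0 then [::] else [:: (-1, 2 * rb)])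
     (p.2%:C)%C * (z / (z - p.1))) = complex.Im z * (rb / (1 + complex.Re z)).
  case: eqP => [->|/eqP h]; first by rewrite big_nil mul0r mulr0.
  by rewrite big_seq1/= ImZ Im_add1_inv ?em// invfM; move: ((1 + complex.Re z)^-1) => u; field.
rewrite E1 E2 !big_map -ImD -big_split/= Im_sum /log_deriv mulrDr mulr_sumr mulrDr.
congr (_ + _); apply: eq_big_seq => x xt.
by rewrite !mul1r Im_node_pair ?t1//; case: (et x xt).
Qed.

End JacobiCircle.

(** * Raising the degree *)

Section Raising.
Variable R : realType.
Variables ra rb : R.
Hypotheses (ra0 : 0 <= ra) (rb0 : 0 <= rb).
Implicit Types (t : seq R) (x y : R).

Lemma zpoly_monic t : zpoly t \is monic.
Proof. exact: monic_prod_XsubC. Qed.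

Lemma size_zpoly t : size (zpoly t) = (size t).+1.
Proof. by rewrite /zpoly size_prod_XsubC. Qed.

(* In the variable [theta] with [x = cos theta], and with [L] the degree of
   [f = w T], this is [(cos theta f + sin theta f' / L) / 2]. *)
Definition raise_poly t : {poly R} :=
  2^-1 *: ('X * zpoly t + (2 * ((size t)%:R + ra + rb))^-1 *:
    ((2 * ra) *: (zpoly t + 'X * zpoly t) - (2 * rb) *: (zpoly t - 'X * zpoly t) -
      2 *: ((zpoly t)^`() - 'X^2 * (zpoly t)^`()))).

Lemma raise_poly_coef t k : (raise_poly t)`_k.+1 =
  2^-1 * ((zpoly t)`_k + (2 * ((size t)%:R + ra + rb))^-1 *
   ((2 * ra) * ((zpoly t)`_k.+1 + (zpoly t)`_k) -
    (2 * rb) * ((zpoly t)`_k.+1 - (zpoly t)`_k) -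
    2 * ((zpoly t)`_k.+2 *+ k.+2 - (zpoly t)`_k *+ k))).
Proof.
rewrite /raise_poly !(coefZ, coefD, coefN, coefXM, coefXnM, coef_deriv)/=.
by case: k => [|k] //=; rewrite subSS subn1.
Qed.

Lemma raise_poly_monic t : 0 < (size t)%:R + ra + rb ->
  raise_poly t \is monic /\ size (raise_poly t) = (size t).+2.
Proof.
move=> L0.
have zc k : (size t < k)%N -> (zpoly t)`_k = 0.
  by move=> h; rewrite nth_default// size_zpoly.
have c1 : (raise_poly t)`_(size t).+1 = 1.
  rewrite raise_poly_coef (zc (size t).+1)// (zc (size t).+2)//.
  have -> : (zpoly t)`_(size t) = 1.
    by have /monicP := zpoly_monic t; rewrite lead_coefE size_zpoly.
  rewrite mul0rn -[1 *+ size t]/((size t)%:R).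
  by field; rewrite gt_eqF.
have s2 : (size (raise_poly t) <= (size t).+2)%N.
  apply/leq_sizeP => -[//|j]; rewrite ltnS => jt.
  rewrite raise_poly_coef (zc j)// (zc j.+1) 1?ltnW// (zc j.+2); last first.
    by rewrite (leqW (leqW jt)).
  by rewrite !mul0rn !(addr0, subr0, mulr0).
have s2' : size (raise_poly t) = (size t).+2.
  apply/eqP; rewrite eqn_leq s2/= ltnNge; apply/negP => h.
  by move: c1; rewrite nth_default// => /eqP; rewrite eq_sym oner_eq0.
by split=> //; rewrite monicE lead_coefE s2' c1.
Qed.

Lemma raise_poly_horner t x : x \notin t -> -1 < x < 1 ->
  0 < (size t)%:R + ra + rb ->
  (raise_poly t).[x] = (zpoly t).[x] / 2 *
   (x - (1 - x ^+ 2) * log_deriv ra rb t x / ((size t)%:R + ra + rb)).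
Proof.
move=> xt /andP[x1 x2] L0; rewrite /raise_poly /log_deriv.
rewrite !(hornerE, hornerXn) zpoly_deriv//.
have h1 : 1 - x != 0 by rewrite gt_eqF//; lra.
have h2 : 1 + x != 0 by rewrite gt_eqF//; lra.
by field; rewrite h1 h2 gt_eqF.
Qed.

Lemma jacobi_half_list t (p : R[i] * R) : (ra = 0 \/ 1 / 2 <= ra) ->
  (rb = 0 \/ 1 / 2 <= rb) -> p \in jacobi_list ra rb t -> 1 <= p.2.
Proof.
move=> ha hb /mem_jacobi_list[[-> /eqP h]|[-> /eqP h]|[x _ [->|->]]]//=.
  by case: ha => // ha; lra.
by case: hb => // hb; lra.
Qed.

Lemma circle_pt_notin t x : -1 < x < 1 -> x \notin t ->
  circle_pt x \notin unzip1 (jacobi_list ra rb t).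
Proof.
move=> /andP[x1 x2] xt; apply/negP => /mapP[p].
move=> /mem_jacobi_list[[-> _]|[-> _]|[y yt [->|->]]] /= []; try lra.
  by move=> xy; move: xt; rewrite xy yt.
by move=> xy; move: xt; rewrite xy yt.
Qed.

Lemma raise_poly_bound_open t (M x : R) :
  (ra = 0 \/ 1 / 2 <= ra) -> (rb = 0 \/ 1 / 2 <= rb) ->
  0 < (size t)%:R + ra + rb -> (forall y, y \in t -> -1 <= y <= 1) ->
  (forall y, -1 <= y <= 1 -> jacobi_weight ra rb y * `|(zpoly t).[y]| <= M) ->
  -1 < x < 1 -> x \notin t ->
  jacobi_weight ra rb x * `|(raise_poly t).[x]| <= M / 2.
Proof.
move=> ha hb L0 t1 tM x1 xt.
have x1' : -1 <= x <= 1 by case/andP: x1 => *; apply/andP; split; exact: ltW.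
have z1 := circle_pt_unit x1'.
have zs := circle_pt_notin x1 xt.
have cs : circle_list (jacobi_list ra rb t) by exact: jacobi_list_circle.
pose C := 2 `^ (ra + rb) * 2 ^+ size t.
have C0 : 0 < C by rewrite mulr_gt0 ?powR_gt0 ?exprn_gt0.
have sM w : normc w = 1 -> mprod (jacobi_list ra rb t) w <= C * M.
  move=> w1; rewrite mprod_jacobi_list// ler_pM2l// -zpoly_horner.
  by rewrite tM// unit_Re_itv.
have := circle_bernstein cs (fun p => jacobi_half_list ha hb) (jacobi_list_sum ra rb t)
  L0 sM z1 zs.
rewrite mprod_jacobi_list//= -zpoly_horner.
set L := (size t)%:R + ra + rb in L0 *.
set N := normc _; set W := jacobi_weight _ _ _.
rewrite -[2 `^ (ra + rb) * 2 ^+ size t]/C -(mulrA C) (mulrCA L) ler_pM2l// => H.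
rewrite raise_poly_horner// -/L !normrM.
have W0 : 0 <= W by exact: jacobi_weight_ge0.
suff NN : `|x - (1 - x ^+ 2) * log_deriv ra rb t x / L| <= N / L.
  have := ler_wpM2l (mulr_ge0 W0 (normr_ge0 (zpoly t).[x])) NN.
  rewrite mulrA => h; rewrite (ger0_norm (_ : 0 <= 2^-1))//.
  have : W * `|(zpoly t).[x]| * N / L <= M.
    by rewrite ler_pdivrMr// (mulrC M).
  lra.
have -> : x - (1 - x ^+ 2) * log_deriv ra rb t x / L =
    (x * L - (1 - x ^+ 2) * log_deriv ra rb t x) / L.
  by field; rewrite gt_eqF.
rewrite normrM (ger0_norm (_ : 0 <= L^-1)) ?invr_ge0 ?(ltW L0)//.
rewrite ler_pM2r ?invr_gt0// -(@ler_pXn2r _ 2) ?nnegrE ?normc_ge0//.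
rewrite real_normK ?num_real// normc_sqr ReD ImD ReN ImN.
rewrite (lsum_Re cs z1 zs) (jacobi_list_sum ra rb t) -/L Im_lsum_jacobi//=.
have := sqr_sqrtr (sqr_le1 x1'); set y := Num.sqrt _.
set l := log_deriv _ _ _ _ => yy.
have -> : 2 * L - 2 * L / 2 = L by field.
have -> : 1 - x ^+ 2 = y ^+ 2 by [].
have xx : x ^+ 2 + y ^+ 2 = 1 by rewrite yy; ring.
have := sqr_ge0 (x * (y * l) + y * L).
have -> : (x * L - y ^+ 2 * l) ^+ 2 =
  (x ^+ 2 + y ^+ 2) * (L ^+ 2 + (y * l) ^+ 2) - (x * (y * l) + y * L) ^+ 2 by ring.
by rewrite xx mul1r sub0r sqrrN; lra.
Qed.

Definition abs_weight x := `|1 - x| `^ ra * `|1 + x| `^ rb.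

Lemma abs_weightE x : -1 <= x <= 1 -> abs_weight x = jacobi_weight ra rb x.
Proof. by move=> /andP[x1 x2]; rewrite /abs_weight !ger0_norm//; lra. Qed.

Lemma abs_weight_continuous : continuous abs_weight.
Proof.
move=> x; apply: cvgM.
  apply: (@powR_continuous_nonneg R R (fun y => `|1 - y|)); [by []|by left|].
  apply: cvg_norm; apply: cvgB; [exact: cvg_cst|exact: cvg_id].
apply: (@powR_continuous_nonneg R R (fun y => `|1 + y|)); [by []|by left|].
by apply: cvg_norm; apply: cvgD; [exact: cvg_cst|exact: cvg_id].
Qed.

Lemma itv_avoid t (a b : R) : a < b ->
  exists a' b', [/\ a <= a', a' < b', b' <= b & forall y, a' < y < b' -> y \notin t].
Proof.
move=> ab; elim: t => [|x t [a' [b' [aa' ab' bb' H]]]]; first by exists a, b.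
have [/andP[ax xb]|xab] := boolP (a' < x < b').
  exists a', x; split=> // [|y /andP[ay yx]]; first exact: le_trans (ltW xb) bb'.
  by rewrite inE negb_or (lt_eqF yx) H// ay (lt_trans yx).
exists a', b'; split=> // y yab; rewrite inE negb_or H// andbT.
by apply: contra xab => /eqP <-.
Qed.

Lemma le_dense_itv t (g : R -> R) (K : R) : continuous g ->
  (forall x, -1 < x < 1 -> x \notin t -> g x <= K) ->
  forall x, -1 <= x <= 1 -> g x <= K.
Proof.
move=> cg H x /andP[x1 x2]; rewrite leNgt; apply/negP => Kx.
have /cvgrPdist_lt := cg x; move=> /(_ (g x - K)); rewrite subr_gt0 => /(_ Kx).
move=> /nbhs_ballP[e /= e0 he].
pose a := Num.max (-1) (x - e); pose b := Num.min 1 (x + e).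
have ab : a < b by rewrite /a /b gt_max !lt_min; lra.
have [a' [b' [aa' ab' bb' Hn]]] := itv_avoid t ab.
have /andP[am mb] : a' < (a' + b') / 2 < b' by rewrite midf_lt ?midf_lt//; lra.
set y := (a' + b') / 2 in am mb.
have := le_lt_trans aa' am; rewrite /a gt_max => /andP[y1 ye].
have := lt_le_trans mb bb'; rewrite /b lt_min => /andP[y2 ye'].
have/he/= : ball x e y.
  by rewrite /ball/= ltr_norml; apply/andP; split; lra.
have := H y; rewrite y1 y2 Hn ?am// => /(_ isT isT) gy.
by rewrite ltr_norml => /andP[]; lra.
Qed.

Lemma raise_poly_bound t (M x : R) :
  (ra = 0 \/ 1 / 2 <= ra) -> (rb = 0 \/ 1 / 2 <= rb) ->
  0 < (size t)%:R + ra + rb -> (forall y, y \in t -> -1 <= y <= 1) ->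
  (forall y, -1 <= y <= 1 -> jacobi_weight ra rb y * `|(zpoly t).[y]| <= M) ->
  -1 <= x <= 1 ->
  jacobi_weight ra rb x * `|(raise_poly t).[x]| <= M / 2.
Proof.
move=> ha hb L0 t1 tM x1; rewrite -abs_weightE//.
apply: (@le_dense_itv t (fun x => abs_weight x * `|(raise_poly t).[x]|)) => //.
  move=> y; apply: cvgM; first exact: abs_weight_continuous.
  by apply: cvg_norm; exact: continuous_horner.
move=> y y1 yt; rewrite abs_weightE; last first.
  by case/andP: y1 => *; apply/andP; split; exact: ltW.
exact: raise_poly_bound_open.
Qed.

Lemma min_norm_succ n : (ra = 0 \/ 1 / 2 <= ra) -> (rb = 0 \/ 1 / 2 <= rb) ->
  0 < n%:R + ra + rb -> min_norm ra rb n.+1 <= min_norm ra rb n / 2.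
Proof.
move=> ha hb L0; rewrite leNgt; apply/negP; rewrite ltr_pdivrMr// => /midf_lt[h1 h2].
have [t [t1 tv]] := min_norm_nodes ra0 rb0 h1.
pose s := [seq t k | k <- enum 'I_n].
have ss : size s = n by rewrite size_map size_enum_ord.
have [pm ps] : raise_poly s \is monic /\ size (raise_poly s) = n.+2.
  by have := @raise_poly_monic s; rewrite ss; exact.
have := min_norm_le ra0 rb0 pm ps; move=> /(_ ((min_norm ra rb n + min_norm ra rb n.+1 * 2) / 2 / 2)).
suff H x : -1 <= x <= 1 -> jacobi_weight ra rb x * `|(raise_poly s).[x]|
    <= (min_norm ra rb n + min_norm ra rb n.+1 * 2) / 2 / 2.
  by move=> /(_ H); lra.
apply: raise_poly_bound => //; first by rewrite ss.
- by move=> y /mapP[k _ ->].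
- by move=> y y1; rewrite zpoly_horner big_map big_enum; exact: tv.
Qed.

Lemma widom_succ n : (ra = 0 \/ 1 / 2 <= ra) -> (rb = 0 \/ 1 / 2 <= rb) ->
  0 < n%:R + ra + rb -> widom ra rb n.+1 <= widom ra rb n.
Proof.
move=> ha hb L0; rewrite !widomE exprSr -mulrA ler_pM2l ?exprn_gt0//.
by rewrite mulrC -ler_pdivlMr// min_norm_succ.
Qed.

End Raising.

(** * Extremal polynomials *)

Section Minimal.
Variable R : realType.
Variables ra rb : R.
Hypotheses (ra0 : 0 <= ra) (rb0 : 0 <= rb).
Implicit Types (s : seq R) (x y : R).

Lemma minimal_nodes n : exists s : seq R,
  [/\ size s = n, forall y, y \in s -> -1 <= y <= 1 &
   forall x, -1 <= x <= 1 ->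
     jacobi_weight ra rb x * `|(zpoly s).[x]| <= min_norm ra rb n].
Proof.
pose box := [set v : 'rV[R]_n | forall i, `[-1, 1]%classic (v ord0 i)].
pose val (v : 'rV[R]_n) x := jacobi_weight ra rb x * `|\prod_(k < n) (x - v ord0 k)|.
pose B (e : R) := [set v | box v /\ forall x, -1 <= x <= 1 -> val v x <= e].
pose D := [set e : R | min_norm ra rb n < e].
have cbox : compact box.
  exact: (@rV_compact R n (fun=> `[-1, 1]%classic) (fun=> @segment_compact R _ _)).
have D1 : D (min_norm ra rb n + 1) by rewrite /D/= ltrDl.
have FF : Filter (filter_from D B).
  apply: filter_from_filter; first by exists (min_norm ra rb n + 1).
  move=> e f De Df; exists (Num.min e f); first by rewrite /D/= lt_min; apply/andP.
  by move=> v [bv vv]; split; split=> // x x1; have := vv x x1; rewrite le_min => /andP[].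
have PF : ProperFilter (filter_from D B).
  apply: filter_from_proper => // e De.
  have [t [t1 tv]] := min_norm_nodes ra0 rb0 De.
  exists (\row_k t k); split=> [i|x x1]; first by rewrite /= mxE in_itv/= t1.
  rewrite /val; under eq_bigr do rewrite mxE.
  exact: tv.
have Fbox : filter_from D B box by exists (min_norm ra rb n + 1) => // v [].
have [v [bv cv]] := cbox _ PF Fbox.
have valE x : -1 <= x <= 1 -> val v x <= min_norm ra rb n.
  move=> x1; apply/ler_addgt0Pr => e e0.
  rewrite clusterE in cv.
  pose C := [set u : 'rV[R]_n | val u x <= min_norm ra rb n + e].
  have closedC : closed C.
    apply: (@preimage_closed _ _ (val^~ x) [set y | y <= min_norm ra rb n + e]);
      last exact: closed_le.
    move=> u _; apply: (@cvgM R _ (nbhs u) _ (cst (jacobi_weight ra rb x))).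
      exact: cvg_cst.
    apply: cvg_norm.
    have : continuous (fun u : 'rV[R]_n => \prod_(k < n) (x - u ord0 k)).
      apply: continuous_big => [w|k _ w].
        by apply: cvgM; [exact: cvg_fst|exact: cvg_snd].
      apply: (@cvgB R R _ (nbhs w) _ (cst x)); first exact: cvg_cst.
      exact: coord_continuous.
    exact.
  apply: closedC; apply: cv; exists (min_norm ra rb n + e); first by rewrite /D/= ltrDl.
  by move=> u [_ uu]; exact: uu.
exists [seq v ord0 k | k <- enum 'I_n]; split.
- by rewrite size_map size_enum_ord.
- by move=> _ /mapP[k _ ->]; have := bv k; rewrite /= in_itv.
- by move=> x x1; rewrite zpoly_horner big_map big_enum; exact: valE.
Qed.

Lemma min_norm_gt0 n : 0 < min_norm ra rb n.
Proof.
have [s [sn s1 sM]] := minimal_nodes n.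
have n11 : (-1 : R) < 1 by lra.
have [a [b [a1 ab b1 H]]] := itv_avoid s n11.
have /andP[am mb] : a < (a + b) / 2 < b by rewrite midf_lt ?midf_lt//; lra.
set x := (a + b) / 2 in am mb.
have xs : x \notin s by apply: H; rewrite am.
have x1 : -1 <= x <= 1 by lra.
apply: lt_le_trans (sM x x1); rewrite mulr_gt0 ?normr_gt0 ?zpoly_neq0//.
by rewrite mulr_gt0 ?powR_gt0//; lra.
Qed.

(* Replacing the factor [D] of the extremal polynomial by [D - sg * e] shrinks
   it wherever [0 <= sg * D]. *)
Lemma extremal_rigid n (D S : {poly R}) (sg m : R) :
  D \is monic -> S \is monic -> (1 < size D)%N -> size (D * S) = n.+1 ->
  `|sg| = 1 ->
  (forall x, -1 <= x <= 1 ->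
    jacobi_weight ra rb x * `|(D * S).[x]| <= min_norm ra rb n) ->
  (forall x, -1 <= x <= 1 ->
    0 <= sg * D.[x] \/ jacobi_weight ra rb x * `|(D * S).[x]| <= m) ->
  min_norm ra rb n <= m.
Proof.
set M := min_norm ra rb n => Dm Sm sD sDS sg1 HM Hm.
rewrite leNgt; apply/negP => mM.
have M0 : 0 < M := min_norm_gt0 n.
have [b0 hb0] := poly_itv_bound D (-1) 1.
have [c0 hc0] := poly_itv_bound S (-1) 1.
pose b := Num.max 1 b0; pose c := 2 `^ ra * 2 `^ rb * Num.max 1 c0 + 1.
have hb x : -1 <= x <= 1 -> `|D.[x]| <= b.
  by move=> /hb0 h; rewrite /b le_max h orbT.
have b1 : 1 <= b by rewrite /b le_max lexx.
have pp : 0 <= (2 : R) `^ ra * 2 `^ rb by rewrite mulr_ge0 ?powR_ge0.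
have hc x : -1 <= x <= 1 -> jacobi_weight ra rb x * `|S.[x]| <= c.
  move=> x1; rewrite /c; apply: ler_wpDr => //.
  rewrite ler_pM ?jacobi_weight_ge0 ?jacobi_weight_le//.
  by rewrite le_max hc0 ?orbT.
have c1 : 1 <= c.
  by rewrite /c lerDr mulr_ge0// le_max ler01.
pose e := Num.min (M / (2 * c)) ((M - m) / (2 * c)).
have e0 : 0 < e by rewrite /e lt_min !divr_gt0 ?mulr_gt0//; lra.
have : e <= e by [].
rewrite {2}/e le_min !ler_pdivlMr; try lra.
move=> /andP[eM em].
pose K := Num.max (M * (1 - e / b)) (Num.max (M / 2) ((M + m) / 2)).
have KM : K < M.
  rewrite /K !gt_max; apply/andP; split; last by apply/andP; split; lra.
  rewrite -[ltRHS]mulr1 ltr_pM2l// ltrBlDr ltrDl divr_gt0//; lra.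
have sc : (size (- (sg * e)%:P) < size D)%N.
  by rewrite size_polyN (leq_ltn_trans (size_polyC_leq1 _)).
pose D' := D - (sg * e)%:P.
have D'm : D' \is monic by rewrite monicE lead_coefDl// -monicE.
have sD' : size (D' * S) = n.+1.
  rewrite size_Mmonic ?monic_neq0//.
  rewrite -sDS size_Mmonic ?monic_neq0// /D' size_polyDl//.
have D'Sm : D' * S \is monic by rewrite monicMl.
have H := @min_norm_le R ra rb ra0 rb0 n (D' * S) K D'Sm sD'.
have {}H : M <= K.
  apply: H => x x1; have w0 := jacobi_weight_ge0 ra rb x.
  have wS := hc x x1.
  pose W := jacobi_weight ra rb x * `|S.[x]|; rewrite -/W in wS.
  have WE (p : {poly R}) : jacobi_weight ra rb x * `|(p * S).[x]| = `|p.[x]| * W.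
    by rewrite hornerM normrM mulrCA.
  have H1 := HM x x1; rewrite !WE in H1 *.
  have W0 : 0 <= W by rewrite mulr_ge0.
  have dE : `|D'.[x]| <= `|D.[x]| + e.
    rewrite /D' hornerD hornerN hornerC (le_trans (ler_normB _ _))//.
    by rewrite normrM sg1 mul1r (gtr0_norm e0).
  have [pos|] := Hm x x1; last first.
    rewrite WE => H2.
    apply: (@le_trans _ _ ((M + m) / 2)); last by rewrite /K !le_max lexx !orbT.
    apply: (le_trans (ler_wpM2r W0 dE)); rewrite mulrDl.
    by have := ler_wpM2l (ltW e0) wS; lra.
  have dN : `|D.[x]| = sg * D.[x].
    by rewrite -[LHS]mul1r -sg1 -normrM ger0_norm.
  have sgsg : sg * sg = 1 by rewrite -[LHS]ger0_norm -?expr2 ?sqr_ge0// normrX sg1 expr1n.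
  have d'N : `|D'.[x]| = `| `|D.[x]| - e |.
    rewrite dN -[LHS]mul1r -sg1 -normrM; congr `| _ |.
    by rewrite /D' hornerD hornerN hornerC mulrBr mulrA sgsg mul1r.
  have [ed|de] := lerP e `|D.[x]|.
    apply: (@le_trans _ _ (M * (1 - e / b))); last by rewrite /K le_max lexx.
    rewrite d'N ger0_norm ?subr_ge0//.
    have e_b : `|D.[x]| - e <= `|D.[x]| * (1 - e / b).
      have : `|D.[x]| * (e / b) <= e.
        by rewrite mulrA ler_pdivrMr ?(lt_le_trans ltr01 b1)// mulrC ler_wpM2l ?hb ?(ltW e0).
      by rewrite mulrBr mulr1; lra.
    apply: (le_trans (ler_wpM2r W0 e_b)); rewrite mulrAC ler_wpM2r//.
    have : 0 <= `|D.[x]| * (1 - e / b) by apply: le_trans e_b; rewrite subr_ge0.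
    rewrite pmulr_rge0//; exact: lt_le_trans ed.
  apply: (@le_trans _ _ (M / 2)); last by rewrite /K !le_max lexx !orbT.
  have : `|D'.[x]| <= e.
    by rewrite d'N ler_norml; have := normr_ge0 D.[x]; lra.
  move=> h; apply: (le_trans (ler_pM (normr_ge0 _) W0 h wS)); lra.
by have := lt_le_trans KM H; rewrite ltxx.
Qed.

Lemma zpoly_rem s y : y \in s -> zpoly s = ('X - y%:P) * zpoly (rem y s).
Proof. by move=> ys; rewrite /zpoly (big_rem y). Qed.

Lemma not_uniq_rem (T : eqType) (s : seq T) : ~~ uniq s ->
  exists2 y, y \in s & y \in rem y s.
Proof.
elim: s => [//|x s ih] /=; rewrite negb_and negbK.
have [xs _|xs /= /ih[y ys yr]] := boolP (x \in s).
  by exists x; rewrite ?eqxx ?mem_head.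
exists y; first by rewrite inE ys orbT.
by have [//|_] := eqVneq x y; rewrite inE yr orbT.
Qed.

Lemma seq_max s : s != [::] -> exists2 l, l \in s & forall k, k \in s -> k <= l.
Proof.
elim: s => [//|x s ih] _; have [->|/ih[l ls lm]] := eqVneq s [::].
  by exists x; rewrite ?mem_head// => k; rewrite inE => /eqP ->.
have [xl|lx] := lerP x l.
  by exists l; [rewrite inE ls orbT|move=> k; rewrite inE => /predU1P[->|/lm]].
exists x; first exact: mem_head.
by move=> k; rewrite inE => /predU1P[->//|/lm kl]; exact: le_trans kl (ltW lx).
Qed.

Lemma seq_min s : s != [::] -> exists2 u, u \in s & forall k, k \in s -> u <= k.
Proof.
move=> s0; have [|l /mapP[u us ->] lm] := @seq_max [seq - x | x <- s].
  by case: (s) s0.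
exists u => // k ks; rewrite -lerN2; apply: lm.
exact: map_f.
Qed.

Section Extremal.
Variable s : seq R.
Let n := size s.
Hypothesis s1 : forall y, y \in s -> -1 <= y <= 1.
Hypothesis sM : forall x, -1 <= x <= 1 ->
  jacobi_weight ra rb x * `|(zpoly s).[x]| <= min_norm ra rb n.

Lemma extremal_rigid1 y (sg m : R) : y \in s -> `|sg| = 1 ->
  (forall x, -1 <= x <= 1 -> 0 <= sg * (x - y) \/
     jacobi_weight ra rb x * `|(zpoly s).[x]| <= m) ->
  min_norm ra rb n <= m.
Proof.
move=> ys sg1 H; have E := zpoly_rem ys.
apply: (@extremal_rigid n ('X - y%:P) (zpoly (rem y s)) sg) => //.
- exact: monicXsubC.
- exact: zpoly_monic.
- by rewrite size_XsubC.
- by rewrite -E size_zpoly.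
- by rewrite -E.
- by move=> x /H; rewrite -E hornerXsubC.
Qed.

Lemma extremal_rigid2 y z (m : R) : y \in s -> z \in rem y s ->
  (forall x, -1 <= x <= 1 -> 0 <= (x - y) * (x - z) \/
     jacobi_weight ra rb x * `|(zpoly s).[x]| <= m) ->
  min_norm ra rb n <= m.
Proof.
move=> ys zs H.
have E : zpoly s = ('X - y%:P) * ('X - z%:P) * zpoly (rem z (rem y s)).
  by rewrite (zpoly_rem ys) (zpoly_rem zs) mulrA.
apply: (@extremal_rigid n (('X - y%:P) * ('X - z%:P))
  (zpoly (rem z (rem y s))) 1) => //.
- by rewrite monicMl monicXsubC.
- exact: zpoly_monic.
- by rewrite size_Mmonic ?monicXsubC ?polyXsubC_eq0// !size_XsubC.
- by rewrite -E size_zpoly.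
- by rewrite normr1.
- by rewrite -E.
- by move=> x /H; rewrite -E hornerM !hornerXsubC mul1r.
Qed.

Lemma extremal_uniq : uniq s.
Proof.
rewrite -[uniq s]negbK; apply/negP => /not_uniq_rem[y ys yr].
have := @extremal_rigid2 y y 0 ys yr; rewrite leNgt min_norm_gt0 => h.
suff : false by []; apply: h => x _; left.
by rewrite -expr2 sqr_ge0.
Qed.

Lemma extremal_interior y : y \in s -> -1 < y < 1.
Proof.
move=> ys; have /andP[y1 y2] := s1 ys.
have M0 := min_norm_gt0 n.
rewrite !lt_neqAle y1 y2 !andbT eq_sym; apply/andP; split; apply/eqP => yE.
  have := @extremal_rigid1 y 1 0 ys (normr1 _); rewrite leNgt M0 => h.
  suff : false by []; apply: h => x x1; left; rewrite yE; lra.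
have := @extremal_rigid1 y (-1) 0 ys (normrN1 _); rewrite leNgt M0 => h.
suff : false by []; apply: h => x x1; left; rewrite yE; lra.
Qed.

Lemma extremal_active x : s != [::] -> -1 <= x <= 1 -> x \notin s ->
  exists y, [/\ -1 <= y <= 1,
    min_norm ra rb n <= jacobi_weight ra rb y * `|(zpoly s).[y]| &
    forall k, k \in s -> 0 <= (y - k) * (x - k)].
Proof.
move=> s0 x1 xs.
pose g y := abs_weight ra rb y * `|(zpoly s).[y]|.
have cg : continuous g.
  move=> y; apply: cvgM; first exact: abs_weight_continuous.
  by apply: cvg_norm; exact: continuous_horner.
have gE y : -1 <= y <= 1 -> g y = jacobi_weight ra rb y * `|(zpoly s).[y]|.
  by move=> y1; rewrite /g abs_weightE.
have xk k : k \in s -> k < x \/ x < k.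
  move=> ks; have [kx|xk|kx] := ltgtP k x; [by left|by right|].
  by move: xs; rewrite -kx ks.
have [A0|/seq_max[l lA lmax]] := eqVneq [seq k <- s | k < x] [::].
  have [u us umin] := seq_min s0.
  have xu k : k \in s -> x < k.
    move=> ks; case: (xk k ks) => // kx.
    by have : k \in [seq k <- s | k < x] by [rewrite mem_filter kx]; rewrite A0.
  have [|c cab cmax] := @EVT_max R g (-1) u _ (continuous_subspaceT cg).
    by case/andP: (s1 us).
  move: cab; rewrite in_itv/= => /andP[c1 cu].
  have c11 : -1 <= c <= 1 by rewrite c1 (le_trans cu)//; case/andP: (s1 us).
  exists c; split=> // [|k ks]; last first.
    by rewrite -mulrNN mulr_ge0// oppr_ge0 subr_le0 ?(le_trans cu) ?umin ?ltW ?xu.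
  rewrite -gE//; apply: (@extremal_rigid1 u 1 _ us (normr1 _)) => y y1.
  have [uy|yu] := lerP u y; first by left; rewrite mul1r subr_ge0.
  right; rewrite -gE//; apply: cmax; rewrite in_itv/= (ltW yu) andbT.
  by case/andP: y1.
move: lA; rewrite mem_filter => /andP[lx ls].
have {}lmax k : k \in s -> k < x -> k <= l.
  by move=> ks kx; apply: lmax; rewrite mem_filter kx.
have /andP[l1 l2] := s1 ls.
have [B0|/seq_min[u uB umin]] := eqVneq [seq k <- s | x < k] [::].
  have kx k : k \in s -> k < x.
    move=> ks; case: (xk k ks) => // kx.
    by have : k \in [seq k <- s | x < k] by [rewrite mem_filter kx]; rewrite B0.
  have [//|c cab cmax] := @EVT_max R g l 1 _ (continuous_subspaceT cg).
  move: cab; rewrite in_itv/= => /andP[lc c1].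
  have c11 : -1 <= c <= 1 by rewrite c1 (le_trans l1).
  exists c; split=> // [|k ks]; last first.
    by rewrite mulr_ge0// subr_ge0 ?(ltW (kx k ks))// (le_trans _ lc)// lmax ?kx.
  rewrite -gE//; apply: (@extremal_rigid1 l (-1) _ ls (normrN1 _)) => y y1.
  have [yl|ly] := lerP y l; first by left; lra.
  right; rewrite -gE//; apply: cmax; rewrite in_itv/= (ltW ly).
  by case/andP: y1.
move: uB; rewrite mem_filter => /andP[xu us].
have {}umin k : k \in s -> x < k -> u <= k.
  by move=> ks kx; apply: umin; rewrite mem_filter kx.
have lu : l < u by exact: lt_trans lx xu.
have /andP[u1 u2] := s1 us.
have [|c cab cmax] := @EVT_max R g l u _ (continuous_subspaceT cg); first exact: ltW.
move: cab; rewrite in_itv/= => /andP[lc cu].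
have c11 : -1 <= c <= 1 by rewrite (le_trans l1 lc) (le_trans cu u2).
exists c; split=> // [|k ks]; last first.
  case: (xk k ks) => h.
    by rewrite mulr_ge0// subr_ge0 ?(ltW h)// (le_trans _ lc)// lmax.
  by rewrite -mulrNN mulr_ge0// oppr_ge0 subr_le0 ?(ltW h)// (le_trans cu)// umin.
rewrite -gE//; apply: (@extremal_rigid2 l u _ ls).
  by rewrite mem_rem_uniq ?extremal_uniq// inE us andbT gt_eqF.
move=> y y1; have [yl|ly] := lerP y l.
  by left; rewrite -mulrNN mulr_ge0// oppr_ge0 subr_le0// (le_trans yl (ltW lu)).
have [uy|yu] := lerP u y.
  by left; rewrite mulr_ge0// subr_ge0// ltW.
by right; rewrite -gE//; apply: cmax; rewrite in_itv/= (ltW ly) ltW.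
Qed.

End Extremal.

Lemma powR_le_tangent (a x y : R) : 0 <= a -> 0 <= y -> (a != 0 -> 0 < x) ->
  y `^ a <= x `^ a * expR (a * (y / x - 1)).
Proof.
move=> a0 y0 ax; have [->|an] := eqVneq a 0; first by rewrite !powRr0 mul0r expR0 mul1r.
have x0 := ax an; have yx0 : 0 <= y / x by rewrite divr_ge0// ltW.
have yE : y = x * (y / x) by rewrite mulrC divfK// gt_eqF.
rewrite {1}yE powRM// ?(ltW x0)// ler_wpM2l ?powR_ge0//.
rewrite (mulrC a) expRM ge0_ler_powR ?nnegrE ?expR_ge0//.
by have := expR_ge1Dx (y / x - 1); rewrite addrCA subrr addr0.
Qed.

Lemma zpoly_le_tangent t x y : (forall k, k \in t -> 0 <= (y - k) * (x - k)) ->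
  x \notin t ->
  `|(zpoly t).[y]| <= `|(zpoly t).[x]| * expR ((y - x) * \sum_(k <- t) (x - k)^-1).
Proof.
rewrite !zpoly_horner; elim: t => [|k t ih] H.
  by rewrite !big_nil mulr0 expR0 mulr1.
rewrite inE negb_or => /andP[xk xt].
rewrite !big_cons !normrM mulrDr expRD mulrACA ler_pM//; last first.
  by apply: ih => // j jt; apply: H; rewrite inE jt orbT.
have xk0 : x - k != 0 by rewrite subr_eq0.
have r0 : 0 <= (y - k) / (x - k).
  have -> : (y - k) / (x - k) = (y - k) * (x - k) / (x - k) ^+ 2 by field.
  by rewrite divr_ge0 ?H ?mem_head ?sqr_ge0.
have -> : y - k = (x - k) * ((y - k) / (x - k)) by field.
rewrite normrM ler_wpM2l// ger0_norm//.
have := expR_ge1Dx ((y - k) / (x - k) - 1); rewrite addrCA subrr addr0.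
by congr (is_true (_ <= expR _)); field.
Qed.

Lemma weighted_le_tangent t x y : -1 <= x <= 1 -> -1 <= y <= 1 ->
  (ra != 0 -> x != 1) -> (rb != 0 -> x != -1) -> x \notin t ->
  (forall k, k \in t -> 0 <= (y - k) * (x - k)) ->
  jacobi_weight ra rb y * `|(zpoly t).[y]| <=
  jacobi_weight ra rb x * `|(zpoly t).[x]| * expR ((y - x) * log_deriv ra rb t x).
Proof.
move=> /andP[x1 x2] /andP[y1 y2] xa xb xt H.
have ha : (1 - y) `^ ra <= (1 - x) `^ ra * expR ((y - x) * - (ra / (1 - x))).
  have c : ra != 0 -> 0 < 1 - x.
    by move=> /xa h; rewrite subr_gt0 lt_neqAle h.
  have := @powR_le_tangent ra (1 - x) (1 - y) ra0; rewrite subr_ge0 => /(_ y2 c).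
  congr (is_true (_ <= _ * expR _)).
  have [->|/c h] := eqVneq ra 0; first by rewrite !mul0r oppr0 mulr0.
  by field; rewrite gt_eqF.
have hb : (1 + y) `^ rb <= (1 + x) `^ rb * expR ((y - x) * (rb / (1 + x))).
  have c : rb != 0 -> 0 < 1 + x.
    by move=> /xb h; rewrite addrC -[1]opprK subr_gt0 lt_neqAle eq_sym h.
  have y1' : 0 <= 1 + y by lra.
  have := @powR_le_tangent rb (1 + x) (1 + y) rb0 y1' c.
  congr (is_true (_ <= _ * expR _)).
  have [->|/c h] := eqVneq rb 0; first by rewrite !mul0r mulr0.
  by field; rewrite gt_eqF.
have hz := zpoly_le_tangent H xt.
rewrite /log_deriv !mulrDr !expRD /jacobi_weight.
have := ler_pM (mulr_ge0 (powR_ge0 _ _) (powR_ge0 _ _)) (normr_ge0 _)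
  (ler_pM (powR_ge0 _ _) (powR_ge0 _ _) ha hb) hz.
by congr (is_true (_ <= _)); ring.
Qed.

Lemma jacobi_list_uniq t : uniq t -> (forall k, k \in t -> -1 < k < 1) ->
  uniq (unzip1 (jacobi_list ra rb t)).
Proof.
move=> tu t1.
have Imp k : k \in t -> 0 < Num.sqrt (1 - k ^+ 2).
  by move=> /t1/andP[k1 k2]; rewrite sqrtr_gt0; nra.
have n11 : (-1 : R[i]) != 1.
  by apply/eqP => -[]; lra.
rewrite /unzip1 /jacobi_list !map_cat -!map_comp.
have cu : uniq ([seq circle_pt x | x <- t] ++ [seq ((circle_pt x)^*)%C | x <- t]).
  rewrite cat_uniq !map_inj_uniq//; last 2 first.
  - by move=> x y [].
  - by move=> x y [].
  rewrite tu andbT/=; apply/hasPn => _ /mapP[x xt ->].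
  apply/negP => /mapP[y yt [_ /eqP]].
  by have := Imp x xt; have := Imp y yt; lra.
have eu : uniq ([seq p.1 | p <- if ra == 0 then [::] else [:: (1, 2 * ra)]] ++
   [seq p.1 | p <- if rb == 0 then [::] else [:: (-1, 2 * rb)]] : seq R[i]).
  by case: (ra == 0); case: (rb == 0) => //=; rewrite inE eq_sym n11.
rewrite cat_uniq eu/= cu andbT; apply/hasPn => z; rewrite mem_cat => hz.
have Imz : complex.Im z != 0.
  by case/orP: hz => /mapP[x /Imp xt ->]/=; rewrite ?oppr_eq0 gt_eqF.
apply: contra Imz; rewrite mem_cat; case: (ra == 0); case: (rb == 0) => /=;
  rewrite ?in_nil ?inE ?orbF//.
- by move=> /eqP ->; rewrite /= oppr0.
- by move=> /eqP ->.
- by move=> /orP[] /eqP -> /=; rewrite ?oppr0.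
Qed.

Lemma widom_le n : ra <= 1 / 2 -> rb <= 1 / 2 -> (0 < n)%N ->
  widom ra rb n <= 2 `^ (1 - ra - rb).
Proof.
move=> ha hb n0.
have [s [sn s1 sM]] := minimal_nodes n; subst n.
have su := extremal_uniq sM; have si := extremal_interior s1 sM.
have s0 : s != [::] by case: (s) n0.
pose C := 2 `^ (ra + rb) * 2 ^+ size s : R.
have L0 : 0 < (size s)%:R + ra + rb.
  by rewrite ltr_pwDl// ltr_pwDl// ltr0n.
have cs : circle_list (jacobi_list ra rb s) by exact: jacobi_list_circle.
have : C * min_norm ra rb (size s) <= 2.
  apply: circle_min_critical cs (jacobi_list_uniq su si) _
    (jacobi_list_sum ra rb s) L0 _.
    move=> p /mem_jacobi_list[[-> h]|[-> h]|[x _ [->|->]]]/=; rewrite ?ltr01 ?lexx//.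
      by have : 0 < ra by [rewrite lt_def h]; lra.
    by have : 0 < rb by [rewrite lt_def h]; lra.
  move=> z z1 zs; rewrite Im_lsum_jacobi// mprod_jacobi_list// -zpoly_horner => I0.
  rewrite ler_wpM2l ?mulr_ge0 ?powR_ge0 ?exprn_ge0//.
  have [ea eb es] := jacobi_list_ends zs.
  have x1 := unit_Re_itv z1; have zz := unit_sqr z1.
  set x := complex.Re z in I0 x1 zz *.
  have xs : x \notin s.
    apply/negP => xs; have [] := es x xs.
    have := conj_pair_factor z1 x1; rewrite subrr mulr0 rmorph0 mulr0 => /eqP.
    by rewrite mulf_eq0 !subr_eq0 => /orP[] /eqP ->; rewrite eqxx.
  have [y [y1 yM yk]] := extremal_active s1 sM s0 x1 xs.
  have Re1 (c : R) : c ^+ 2 = 1 -> x = c -> z = (c%:C)%C.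
    move=> c1 xc; apply/eqP; rewrite eq_complex/= -/x xc eqxx/= -sqrf_eq0.
    by rewrite xc c1 in zz; apply/eqP; lra.
  have xa : ra != 0 -> x != 1.
    by move=> /ea; apply: contra => /eqP /(Re1 1 (expr1n _ _)) ->.
  have xb : rb != 0 -> x != -1.
    move=> /eb; apply: contra => /eqP /(Re1 (-1)) ->; first by rewrite rmorphN1.
    by rewrite sqrrN expr1n.
  apply: (le_trans yM); apply: (le_trans (weighted_le_tangent x1 y1 xa xb xs yk)).
  apply: ler_piMr; first by rewrite mulr_ge0 ?jacobi_weight_ge0.
  rewrite expR_le1.
  move/eqP: I0; rewrite mulf_eq0 => /orP[/eqP I0|/eqP ->]; last by rewrite mulr0.
  rewrite I0 expr0n addr0 in zz; move/eqP: zz; rewrite sqrf_eq1 => /orP[] /eqP xE.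
    have -> : ra = 0 by apply/eqP; apply: contraT => /xa; rewrite xE eqxx.
    rewrite mulr_le0_ge0//; first by case/andP: y1; lra.
    rewrite /log_deriv mul0r oppr0 add0r xE addr_ge0//; first by rewrite divr_ge0//; lra.
    by rewrite big_seq sumr_ge0// => k /si/andP[k1 k2]; rewrite invr_ge0; lra.
  have rb00 : rb = 0 by apply/eqP; apply: contraT => /xb; rewrite xE eqxx.
  rewrite mulr_ge0_le0//; first by case/andP: y1; lra.
  rewrite /log_deriv rb00 mul0r addr0 xE addrC -oppr_ge0 opprD opprK addr_ge0//.
    rewrite -sumrN big_seq sumr_ge0// => k /si/andP[k1 k2].
    by rewrite -invrN invr_ge0; lra.
  by rewrite divr_ge0//; lra.
rewrite widomE /C -mulrA -ler_pdivlMl ?powR_gt0// => H; apply: (le_trans H).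
have -> : 1 - ra - rb = - (ra + rb) + 1 by ring.
rewrite [leRHS]powRD; last by rewrite pnatr_eq0 implybT.
by rewrite powRN powRr1.
Qed.

End Minimal.

(** * Asymptotics *)

Section Asymptotics.
Variable R : realType.
Implicit Types (p q : {poly R}) (z w : R[i]) (x y e : R).

Definition cval p z : R[i] := (map_poly (real_complex R) p).[z].

Lemma cval_poly n (E : nat -> R) z :
  cval (\poly_(k < n) E k) z = \sum_(k < n) ((E k)%:C)%C * z ^+ k.
Proof.
rewrite /cval poly_def rmorph_sum/= horner_sum; apply: eq_bigr => k _.
by rewrite map_polyZ/= map_polyXn hornerZ hornerXn.
Qed.

Lemma cval_expand n p z : (size p <= n)%N ->
  cval p z = \sum_(k < n) ((p`_k)%:C)%C * z ^+ k.
Proof.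
move=> pn; rewrite -(cval_poly n (fun k => p`_k)); congr cval.
apply/polyP => k; rewrite coef_poly; case: ltnP => // nk.
by rewrite nth_default// (leq_trans pn).
Qed.

Lemma cvalD p q z : cval (p + q) z = cval p z + cval q z.
Proof. by rewrite /cval rmorphD hornerD. Qed.

Lemma cvalZ x p z : cval (x *: p) z = (x%:C)%C * cval p z.
Proof. by rewrite /cval map_polyZ/= hornerZ. Qed.

Lemma cvalX p n z : cval (p ^+ n) z = cval p z ^+ n.
Proof. by rewrite /cval rmorphXn/= horner_exp. Qed.

Lemma cval1 z : cval 1 z = 1.
Proof. by rewrite /cval rmorph1 hornerC. Qed.

Lemma cval_comp_opp p z : cval (p \Po (- 'X)) z = cval p (- z).
Proof.
by rewrite /cval map_comp_poly horner_comp rmorphN/= map_polyX hornerN hornerX.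
Qed.

Lemma Re_sum (I : Type) (s : seq I) (P : pred I) (f : I -> R[i]) :
  complex.Re (\sum_(i <- s | P i) f i) = \sum_(i <- s | P i) complex.Re (f i).
Proof. by apply: (big_morph _ (@ReD R)). Qed.

Lemma Im_sum (I : Type) (s : seq I) (P : pred I) (f : I -> R[i]) :
  complex.Im (\sum_(i <- s | P i) f i) = \sum_(i <- s | P i) complex.Im (f i).
Proof. by apply: (big_morph _ (@ImD R)). Qed.

Lemma exprn_small (r : R) e : 0 <= r < 1 -> 0 < e -> exists k, r ^+ k <= e.
Proof.
move=> /andP[r0 r1] e0.
have /cvgrPdist_lt/(_ _ e0) [k _ /(_ k (leqnn k))] : r ^+ k @[k --> \oo] --> (0 : R).
  by apply: cvg_expr; rewrite ger0_norm.
by rewrite sub0r normrN ger0_norm ?exprn_ge0// => /ltW h; exists k.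
Qed.

Lemma normc_sub_radial z (r : R) : normc z = 1 -> 0 <= r ->
  normc (1 - z) <= 2 / (1 + r) * normc (1 - (r%:C)%C * z).
Proof.
move=> z1 r0; have r1 : 0 < 1 + r by lra.
rewrite -(@ler_pXn2r _ 2) ?nnegrE ?normc_ge0 ?mulr_ge0 ?normc_ge0 ?invr_ge0 ?(ltW r1)//.
rewrite exprMn expr_div_n !normc_sqr mulrAC ler_pdivlMr ?exprn_gt0//.
have /andP[c1 c2] := unit_Re_itv z1; have := unit_sqr z1.
case: (z) c1 c2 => a b /= c1 c2 h.
rewrite !mul0r !sub0r !subr0 !addr0.
have -> : (1 - a) ^+ 2 + (- b) ^+ 2 = 2 * (1 - a) by lra.
have -> : (1 - r * a) ^+ 2 + (- (r * b)) ^+ 2 = 1 - 2 * r * a + r ^+ 2 * (a ^+ 2 + b ^+ 2).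
  by ring.
have := sqr_ge0 (1 - r); nra.
Qed.

Definition log_poly (r : R) K : {poly R} := \poly_(k < K.+1) (r ^+ k / k%:R).

Lemma Re_log_poly_le (r : R) K z : normc z = 1 -> 0 < r < 1 ->
  normc (1 - (r%:C)%C * z) * expR (complex.Re (cval (log_poly r K) z)) <=
  expR (r ^+ K / (1 - r)).
Proof.
move=> z1 /andP[r0 r1].
pose G : {poly R} := \poly_(k < K.+1) (complex.Re (z ^+ k) / k%:R).
have -> : complex.Re (cval (log_poly r K) z) = G.[r].
  rewrite cval_poly Re_sum horner_poly; apply: eq_bigr => k _.
  by rewrite ReZ mulrAC [RHS]mulrC mulrA.
pose N (y : R) := (1 - 2 * complex.Re z * y + y ^+ 2).
have NE y : N y = normc (1 - (y%:C)%C * z) ^+ 2.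
  rewrite /N normc_sqr; have := unit_sqr z1; case: (z) => a b /= h.
  have -> : (1 - (y * a - 0 * b)) ^+ 2 + (0 - (y * b + 0 * a)) ^+ 2 =
     1 - 2 * a * y + y ^+ 2 * (a ^+ 2 + b ^+ 2) by ring.
  by rewrite h mulr1.
have nc y : 0 <= y <= r -> 1 - y <= normc (1 - (y%:C)%C * z).
  move=> /andP[y0 _]; have := normc_le_add (1 - (y%:C)%C * z) ((y%:C)%C * z).
  rewrite subrK ComplexField.Normc.normc1 ComplexField.Normc.normcM z1 mulr1.
  by rewrite normc_real ger0_norm//; lra.
pose d := r ^+ K / (1 - r).
have r10 : 0 < 1 - r by lra.
have N0 y : 0 <= y <= r -> 0 < N y.
  move=> yr; rewrite NE exprn_gt0//; apply: lt_le_trans (nc y yr).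
  by case/andP: yr; lra.
have G'E y : G^`().[y] * N y = complex.Re z - y -
    complex.Re (z * ((y%:C)%C * z) ^+ K * ((1 - (y%:C)%C * z)^*)%C).
  have -> : G^`() = \poly_(k < K) complex.Re (z ^+ k.+1).
    apply/polyP => k; rewrite coef_deriv !coef_poly ltnS; case: ltnP => kK.
      by rewrite -[LHS]mulr_natr divfK// pnatr_eq0.
    by rewrite mul0rn.
  pose S := \sum_(k < K) ((y%:C)%C * z) ^+ k.
  have SE : (1 - (y%:C)%C * z) * S = 1 - ((y%:C)%C * z) ^+ K.
    by rewrite -[in RHS](expr1n _ K) subrXX; congr (_ * _);
      apply: eq_bigr => k _; rewrite expr1n mul1r.
  have -> : (\poly_(k < K) complex.Re (z ^+ k.+1)).[y] = complex.Re (z * S).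
    rewrite horner_poly /S mulr_sumr Re_sum; apply: eq_bigr => k _.
    by rewrite exprMn mulrCA -exprS -rmorphXn/= ReZ mulrC.
  have NC : ((N y)%:C)%C = (1 - (y%:C)%C * z) * ((1 - (y%:C)%C * z)^*)%C.
    rewrite NE normc_sqr; case: (1 - _) => a b; apply/eqP; rewrite eq_complex/=.
    by apply/andP; split; apply/eqP; ring.
  rewrite mulrC -ReZ NC.
  have -> : (1 - (y%:C)%C * z) * ((1 - (y%:C)%C * z)^*)%C * (z * S) =
     z * ((1 - (y%:C)%C * z) * S) * ((1 - (y%:C)%C * z)^*)%C by ring.
  rewrite SE mulrBr mulr1 mulrBl ReD ReN; congr (_ - _).
  have := unit_sqr z1; case: (z) => a b /= h.
  by rewrite -[X in _ = _ - X]mulr1 -[X in _ = _ - _ * X]h; ring.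
pose F (y : R) := G.[y] + (2^-1 * ln (N y) - d * y).
have dF y : 0 <= y <= r -> is_derive y 1 F
    (G^`().[y] + (2^-1 * ((N y)^-1 * (2 * (y - complex.Re z))) - d)).
  move=> yr.
  have dN : is_derive y 1 N (2 * (y - complex.Re z)).
    have -> : N = horner (1 - (2 * complex.Re z) *: 'X + 'X^2).
      by apply/funext => u; rewrite /N !hornerE.
    set P := (1 - _ + _); have -> : 2 * (y - complex.Re z) = P^`().[y].
      by rewrite /P !(derivD, derivN, derivZ, derivX, derivXn, derivC) !hornerE /=; ring.
    exact: is_derive_poly.
  have dl := is_derive1_comp (is_derive1_ln (N0 y yr)) dN.
  have dp := is_derive_poly G y.
  apply: is_derive_eq.
  by rewrite /GRing.scale/=; ring.
have F'le y : 0 <= y <= r ->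
    G^`().[y] + (2^-1 * ((N y)^-1 * (2 * (y - complex.Re z))) - d) <= 0.
  move=> yr; have Ny := N0 y yr; have /andP[y0 y_r] := yr.
  rewrite -(pmulr_rle0 _ Ny) mulrDr (mulrC (N y)) G'E.
  set E := complex.Re (_ * _ * _).
  have -> : complex.Re z - y - E + N y * (2^-1 * ((N y)^-1 * (2 * (y - complex.Re z))) - d) =
    - E - N y * d by field; rewrite gt_eqF.
  have En : - E <= y ^+ K * normc (1 - (y%:C)%C * z).
    apply: le_trans (ler_norm _) _; rewrite normrN; apply: le_trans (normc_ge_Re _) _.
    rewrite !ComplexField.Normc.normcM z1 mul1r normcX ComplexField.Normc.normcM z1.
    by rewrite mulr1 normc_real ger0_norm// normc_conj.
  rewrite subr_le0; apply: (le_trans En).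
  have nn := nc y yr; rewrite NE expr2 -mulrA mulrCA mulrC.
  rewrite ler_wpM2l ?normc_ge0//.
  have yK : y ^+ K <= r ^+ K by apply: lerXn2r; rewrite ?nnegrE ?(ltW r0).
  apply: (le_trans yK).
  have -> : r ^+ K = d * (1 - r) by rewrite /d divfK// gt_eqF.
  rewrite mulrC ler_wpM2r ?divr_ge0 ?exprn_ge0 ?(ltW r0) ?(ltW r10)//.
  by apply: le_trans nn; lra.
have Fr : F r <= F 0.
  have itv y : y \in `]0, r[ -> 0 <= y <= r.
    by rewrite in_itv/= => /andP[h1 h2]; rewrite !ltW.
  apply: (@ler0_derive1_nincr R F 0 r) => //; [| | |exact: ltW].
  - by move=> y /itv/dF [].
  - move=> y /itv yr; have dFy := dF y yr; rewrite derive1E derive_val.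
    exact: F'le.
  - apply: derivable_within_continuous => y; rewrite in_itv/= => yr; by case: (dF y yr).
have F0 : F 0 = 0.
  have N01 : N 0 = 1 by rewrite /N; ring.
  by rewrite /F N01 ln1 horner_coef0 coef_poly/= invr0 !mulr0 subr0 addr0.
rewrite F0 in Fr.
have rr : 0 <= r <= r by rewrite (ltW r0)/=.
have nr := nc r rr; have nr0 : 0 < normc (1 - (r%:C)%C * z) by lra.
rewrite -[X in X * _ <= _]lnK ?posrE// -expRD ler_expR.
have := Fr; rewrite /F NE lnXn// -mulr_natr.
have dr : d * r <= d.
  by rewrite ler_piMr ?(ltW r1)// /d divr_ge0 ?exprn_ge0 ?(ltW r0) ?(ltW r10).
by rewrite -/d; lra.
Qed.

Lemma log_approx e : 0 < e -> exists2 p, p.[0] = 0 &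
  forall z, normc z = 1 -> normc (1 - z) * expR (complex.Re (cval p z)) <= expR e.
Proof.
move=> e0; pose r := 1 - Num.min (e / 2) (1 / 2).
have m0 : 0 < Num.min (e / 2) (1 / 2) by rewrite lt_min !divr_gt0.
have m1 : Num.min (e / 2) (1 / 2) <= 1 / 2 by rewrite ge_min lexx orbT.
have m2 : Num.min (e / 2) (1 / 2) <= e / 2 by rewrite ge_min lexx.
have r1 : 0 < r < 1 by rewrite /r; lra.
have [r0 r10] : 0 < r /\ 0 < 1 - r by rewrite /r; lra.
have [K Kr] : exists k, r ^+ k <= (1 - r) * (e / 2).
  by apply: exprn_small; [rewrite /r; lra|rewrite mulr_gt0 ?divr_gt0].
exists (log_poly r K); first by rewrite horner_coef0 coef_poly/= invr0 mulr0.
move=> z z1; have h := Re_log_poly_le K z1 r1.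
have := ler_wpM2r (expR_ge0 (complex.Re (cval (log_poly r K) z)))
  (normc_sub_radial z1 (ltW r0)).
move/le_trans; apply; rewrite -(mulrA (2 / (1 + r))).
have r2 : 0 <= 2 / (1 + r) by rewrite divr_ge0//; lra.
apply: (le_trans (ler_wpM2l r2 h)).
have : 2 / (1 + r) <= expR (e / 2).
  apply: le_trans (expR_ge1Dx _); rewrite ler_pdivrMr; last lra.
  by rewrite /r; nra.
move=> h2; have h3 : expR (r ^+ K / (1 - r)) <= expR (e / 2).
  by rewrite ler_expR ler_pdivrMr// mulrC.
apply: (le_trans (ler_pM r2 (expR_ge0 _) h2 h3)).
by rewrite -expRD ler_expR; lra.
Qed.

Lemma cval_bound p z : normc z = 1 ->
  normc (cval p z) <= \sum_(k < size p) `|p`_k|.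
Proof.
move=> z1; rewrite (cval_expand (n := size p))//.
have tri (I : Type) (s : seq I) (f : I -> R[i]) :
    normc (\sum_(i <- s) f i) <= \sum_(i <- s) normc (f i).
  elim: s => [|i s ih]; first by rewrite !big_nil ComplexField.Normc.normc0.
  by rewrite !big_cons (le_trans (normc_le_add _ _))// lerD2l.
apply: (le_trans (tri _ _ _)); apply: ler_sum => k _.
by rewrite ComplexField.Normc.normcM normc_real normcX z1 expr1n mulr1.
Qed.

Lemma cval_real p x : cval p (x%:C)%C = ((p.[x])%:C)%C.
Proof. by rewrite /cval horner_map. Qed.

Definition exp_poly p J : {poly R} := 1 + J%:R^-1 *: p.

Lemma exp_poly0 p J : p.[0] = 0 -> (exp_poly p J).[0] = 1.
Proof. by move=> p0; rewrite /exp_poly hornerD hornerZ p0 mulr0 addr0 hornerC. Qed.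

Lemma cval_exp_poly p J z : cval (exp_poly p J) z = 1 + ((J%:R^-1)%:C)%C * cval p z.
Proof. by rewrite /exp_poly cvalD cval1 cvalZ. Qed.

Lemma normc_exp_poly_le p J z : (0 < J)%N ->
  normc (cval (exp_poly p J) z) ^+ J <=
  expR (complex.Re (cval p z) + normc (cval p z) ^+ 2 / J%:R).
Proof.
move=> J0; have J0' : 0 < J%:R :> R by rewrite ltr0n.
rewrite cval_exp_poly; set w := cval p z; set u := _ * w.
have h : normc (1 + u) <= expR (complex.Re u + normc u ^+ 2 / 2).
  rewrite -(@ler_pXn2r _ 2) ?nnegrE ?normc_ge0 ?expR_ge0// -expRM_natl.
  apply: le_trans (expR_ge1Dx _); rewrite !normc_sqr ReD ImD/=; lra.
apply: (le_trans (lerXn2r _ _ _ h)); rewrite ?nnegrE ?normc_ge0 ?expR_ge0//.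
rewrite -expRM_natl ler_expR /u ReZ ComplexField.Normc.normcM normc_real.
rewrite ger0_norm ?invr_ge0 ?(ltW J0')//.
have -> : J%:R * (J%:R^-1 * complex.Re w + (J%:R^-1 * normc w) ^+ 2 / 2) =
  complex.Re w + normc w ^+ 2 / J%:R / 2 by field; rewrite gt_eqF.
have : 0 <= normc w ^+ 2 / J%:R by rewrite divr_ge0 ?sqr_ge0 ?(ltW J0').
lra.
Qed.

Lemma normc_exp_poly_ge p J z : (0 < J)%N ->
  2 * `|complex.Re (cval p z)| <= J%:R ->
  0 < complex.Re (cval (exp_poly p J) z) /\
  expR (complex.Re (cval p z) - 2 * normc (cval p z) ^+ 2 / J%:R) <=
  normc (cval (exp_poly p J) z) ^+ J.
Proof.
move=> J0; have J0' : 0 < J%:R :> R by rewrite ltr0n.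
rewrite cval_exp_poly; set w := cval p z; set v := complex.Re w => vJ.
pose u := J%:R^-1 * v.
have u2 : `|u| <= 2^-1.
  rewrite /u normrM ger0_norm ?invr_ge0 ?(ltW J0')// mulrC ler_pdivrMr//; lra.
have up : 0 < 1 + u by move: u2; rewrite ler_norml => /andP[]; lra.
have Re1 : complex.Re (1 + ((J%:R^-1)%:C)%C * w) = 1 + u by rewrite ReD ReZ.
rewrite Re1; split=> //.
have h : expR (u - u ^+ 2 *+ 2) <= normc (1 + ((J%:R^-1)%:C)%C * w).
  apply: le_trans (normc_ge_Re _); rewrite Re1 gtr0_norm//.
  by rewrite -[leRHS]lnK ?posrE// ler_expR ln1D_ge.
apply: le_trans (lerXn2r _ _ _ h); rewrite ?nnegrE ?normc_ge0 ?expR_ge0//.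
rewrite -expRM_natl ler_expR.
have -> : J%:R * (u - u ^+ 2 *+ 2) = v - 2 * v ^+ 2 / J%:R.
  by rewrite /u; field; rewrite gt_eqF.
rewrite lerD2l lerN2 ler_pM2r ?invr_gt0// ler_pM2l//.
by rewrite normc_sqr lerDl sqr_ge0.
Qed.

Lemma log_approx2 (s1 s2 : R) e : 0 <= s1 -> 0 <= s2 -> 0 < e ->
  exists2 p, p.[0] = 0 & forall z, normc z = 1 ->
   normc (1 - z) `^ s1 * normc (1 + z) `^ s2 * expR (complex.Re (cval p z)) <= expR e.
Proof.
move=> s10 s20 e0; have ss : 0 < 1 + s1 + s2 by lra.
have [p p0 pe] := log_approx (divr_gt0 e0 ss).
exists (s1 *: p + s2 *: (p \Po (- 'X))).
  by rewrite hornerD !hornerZ horner_comp !hornerE oppr0 p0 !mulr0 addr0.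
move=> z z1; rewrite cvalD !cvalZ cval_comp_opp ReD !ReZ expRD.
have h1 := pe z z1; have := pe (- z); rewrite (@normcN R) => /(_ z1).
rewrite opprK => h2.
set E := expR (e / _) in h1 h2.
have pw (u v c : R) : 0 <= c -> 0 <= u -> u * expR v <= E ->
    u `^ c * expR (c * v) <= E `^ c.
  move=> c0 u0 h; rewrite mulrC (mulrC c) expRM -powRM ?expR_ge0// mulrC.
  by rewrite ge0_ler_powR ?nnegrE ?mulr_ge0 ?expR_ge0.
rewrite mulrACA; have := ler_pM (mulr_ge0 (powR_ge0 _ _) (expR_ge0 _))
  (mulr_ge0 (powR_ge0 _ _) (expR_ge0 _))
  (pw _ _ _ s10 (normc_ge0 _) h1) (pw _ _ _ s20 (normc_ge0 _) h2).
move/le_trans; apply; rewrite /E -!expRM -expRD ler_expR -mulrDr mulrAC.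
by rewrite ler_pdivrMr// ler_pM2l//; lra.
Qed.

Lemma nat_above x : exists2 n : nat, (0 < n)%N & x <= n%:R.
Proof.
exists (Num.truncn x).+1 => //; exact: ltW (truncnS_gt x).
Qed.

Lemma upper_approx (s1 s2 : R) e : 0 <= s1 -> 0 <= s2 -> 0 < e ->
  exists2 q, q.[0] = 1 & forall z, normc z = 1 ->
   normc (1 - z) `^ s1 * normc (1 + z) `^ s2 * normc (cval q z) <= expR e.
Proof.
move=> s10 s20 e0; have e2 : 0 < e / 2 by rewrite divr_gt0.
have [p p0 pe] := log_approx2 s10 s20 e2.
pose B := \sum_(k < size p) `|p`_k|.
have [J J0 JB] := nat_above (B ^+ 2 / (e / 2)).
exists (exp_poly p J ^+ J); first by rewrite horner_exp exp_poly0 ?expr1n.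
move=> z z1; rewrite cvalX normcX.
have n0 : 0 <= normc (1 - z) `^ s1 * normc (1 + z) `^ s2 by rewrite mulr_ge0 ?powR_ge0.
apply: (le_trans (ler_wpM2l n0 (normc_exp_poly_le p z J0))).
rewrite expRD mulrA.
apply: (@le_trans _ _ (expR (e / 2) * expR (e / 2))); last first.
  by rewrite -expRD ler_expR; lra.
rewrite ler_pM ?mulr_ge0 ?expR_ge0 ?powR_ge0 ?pe// ler_expR.
rewrite ler_pdivrMr ?ltr0n//.
have B2 : normc (cval p z) ^+ 2 <= B ^+ 2.
  by apply: lerXn2r; rewrite ?nnegrE ?normc_ge0 ?sumr_ge0 ?cval_bound.
by apply: (le_trans B2); rewrite mulrC -ler_pdivrMr.
Qed.

Lemma lower_approx (s1 s2 : R) e : 0 <= s1 -> 0 <= s2 -> 0 < e ->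
  exists q J, q.[0] = 1 /\ forall z, normc z = 1 -> 0 < complex.Re (cval q z) /\
   normc (1 - z) `^ s1 * normc (1 + z) `^ s2 <= expR e * normc (cval q z) ^+ J.
Proof.
move=> s10 s20 e0; have e2 : 0 < e / 2 by rewrite divr_gt0.
have [p p0 pe] := log_approx2 s10 s20 e2.
pose B := \sum_(k < size p) `|p`_k|.
have B0 : 0 <= B by exact: sumr_ge0.
have [J J0 JB] := nat_above (2 * B ^+ 2 / (e / 2) + 2 * B).
have J0' : 0 < J%:R :> R by rewrite ltr0n.
have [JB1 JB2] : 2 * B ^+ 2 / (e / 2) <= J%:R /\ 2 * B <= J%:R.
  have : 0 <= 2 * B ^+ 2 / (e / 2) by rewrite !divr_ge0 ?mulr_ge0 ?sqr_ge0 ?(ltW e0).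
  by lra.
exists (exp_poly (- p) J), J; split; first by rewrite exp_poly0 ?hornerN ?p0 ?oppr0.
move=> z z1.
have cN : cval (- p) z = - cval p z by rewrite /cval rmorphN hornerN.
have cB := cval_bound p z1; rewrite -/B in cB.
have [|q0 qJ] := @normc_exp_poly_ge (- p) J z J0.
  rewrite cN ReN normrN; apply: le_trans JB2; rewrite ler_pM2l//.
  exact: le_trans (normc_ge_Re _) cB.
split=> //; rewrite cN ReN (@normcN R) in qJ.
apply: le_trans (ler_wpM2l (expR_ge0 e) qJ); rewrite -expRD.
have := pe z z1; rewrite -ler_pdivlMr ?expR_gt0// => /le_trans; apply.
rewrite -expRN -expRD ler_expR.
suff : 2 * normc (cval p z) ^+ 2 / J%:R <= e / 2 by lra.
rewrite ler_pdivrMr//.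
have B2 : normc (cval p z) ^+ 2 <= B ^+ 2.
  by apply: lerXn2r; rewrite ?nnegrE ?normc_ge0.
apply: (@le_trans _ _ (2 * B ^+ 2)); first by rewrite ler_pM2l.
by rewrite -ler_pdivrMl// mulrC.
Qed.

Fixpoint cheb n : {poly R} :=
  if n is n1.+1 then
    if n1 is n2.+1 then 2 *: ('X * cheb n1) - cheb n2 else 'X
  else 1.

Lemma chebSS n : cheb n.+2 = 2 *: ('X * cheb n.+1) - cheb n.
Proof. by []. Qed.

Lemma cheb_Re n z : normc z = 1 -> (cheb n).[complex.Re z] = complex.Re (z ^+ n).
Proof.
move=> z1; suff : (cheb n).[complex.Re z] = complex.Re (z ^+ n) /\
    (cheb n.+1).[complex.Re z] = complex.Re (z ^+ n.+1) by case.
elim: n => [|n [ih1 ih2]]; first by rewrite hornerC hornerX expr0 expr1.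
split=> //; rewrite chebSS hornerD hornerN hornerZ hornerM hornerX ih1 ih2.
have -> : z ^+ n.+2 = ((2 * complex.Re z)%:C)%C * z ^+ n.+1 - z ^+ n.
  have zz : z ^+ 2 = ((2 * complex.Re z)%:C)%C * z - 1.
    have := unit_sqr z1; case: (z) => a b /= h.
    by apply/eqP; rewrite expr2 eq_complex/=; apply/andP; split; apply/eqP; lra.
  by rewrite -addn2 addnC exprD zz mulrBl mul1r -mulrA -exprS.
by rewrite ReD ReN ReZ; ring.
Qed.

Lemma size_cheb n : (size (cheb n) <= n.+1)%N.
Proof.
suff : (size (cheb n) <= n.+1)%N /\ (size (cheb n.+1) <= n.+2)%N by case.
elim: n => [|n [ih1 ih2]]; first by rewrite size_poly1 size_polyX.
split=> //; rewrite chebSS (leq_trans (size_polyD _ _))// geq_max size_polyN.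
apply/andP; split; last by rewrite (leq_trans ih1)// ltnW.
by rewrite (leq_trans (size_scale_leq _ _))// (leq_trans (size_polyMleq _ _))// size_polyX.
Qed.

Lemma cheb_lead n : (cheb n.+1)`_n.+1 = 2 ^+ n.
Proof.
elim: n => [|n ih]; first by rewrite coefX.
rewrite chebSS coefB coefZ coefXM/= ih exprS [(cheb n)`__]nth_default ?subr0//.
by rewrite (leq_trans (size_cheb n)).
Qed.

#[local] Arguments cheb : simpl never.

Definition cos_poly N q : {poly R} :=
  2 ^- N *: \sum_(k < size q) q`_k *: cheb (N.+1 - k).

Lemma cos_poly_horner N q z : normc z = 1 -> (size q <= N.+1)%N ->
  (cos_poly N q).[complex.Re z] =
  2 ^- N * complex.Re (z ^+ N.+1 * ((cval q z)^*)%C).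
Proof.
move=> z1 qN; rewrite /cos_poly hornerZ horner_sum; congr (_ * _).
rewrite (cval_expand (n := size q))// rmorph_sum mulr_sumr Re_sum.
apply: eq_bigr => k _; rewrite hornerZ cheb_Re// -ReZ; congr complex.Re.
have kN : (k <= N.+1)%N by rewrite (leq_trans _ qN)// ltnW.
rewrite -[RHS]/(z ^+ N.+1 * (((q`_k)%:C * z ^+ k)^*)%C).
have -> : (((q`_k)%:C * z ^+ k)^*)%C = ((q`_k)%:C)%C * z^-1 ^+ k.
  by rewrite -unit_circle_conj// rmorphM rmorphXn; congr (_ * _); rewrite /= oppr0.
rewrite mulrCA; congr (_ * _).
have z0 : z \is a GRing.unit by rewrite unitfE -normc_eq0 z1 oner_eq0.
by rewrite exprVn -{2}(subnK kN) exprD mulrK// unitrX.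
Qed.

Lemma cos_poly_monic N q : q.[0] = 1 -> (size q <= N.+1)%N ->
  cos_poly N q \is monic /\ size (cos_poly N q) = N.+2.
Proof.
rewrite horner_coef0 => q0 qN.
have sq : (0 < size q)%N.
  by rewrite lt0n; apply: contra_eq_neq q0 => /size0nil ->; rewrite nth_nil eq_sym oner_eq0.
have c1 : (cos_poly N q)`_N.+1 = 1.
  rewrite /cos_poly coefZ coef_sum (bigD1 (Ordinal sq))//= big1 ?addr0.
    by rewrite coefZ q0 mul1r subn0 cheb_lead mulVf// expf_neq0.
  move=> k k0; rewrite coefZ [(cheb _)`__]nth_default ?mulr0//.
  rewrite (leq_trans (size_cheb _))//.
  have : (0 < k)%N by rewrite lt0n; apply: contra k0 => /eqP k0; apply/eqP/val_inj.
  have : (k < N.+1)%N by rewrite (leq_trans _ qN).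
  by move: (k : nat) => j jN j0; rewrite -subSn ?(ltnW jN)// leq_subLR -addn1 addnC leq_add2r.
have s2 : (size (cos_poly N q) <= N.+2)%N.
  rewrite /cos_poly (leq_trans (size_scale_leq _ _))//.
  apply: (leq_trans (size_sum _ _ _)); apply/bigmax_leqP => k _.
  rewrite (leq_trans (size_scale_leq _ _))// (leq_trans (size_cheb _))// ltnS.
  exact: leq_subr.
have s2' : size (cos_poly N q) = N.+2.
  apply/eqP; rewrite eqn_leq s2/= ltnNge; apply/negP => h.
  by move: c1; rewrite nth_default// => /eqP; rewrite eq_sym oner_eq0.
by split=> //; rewrite monicE lead_coefE s2' c1.
Qed.

Lemma jacobi_weight_circle (ra rb : R) z : normc z = 1 ->
  normc (1 - z) `^ (2 * ra) * normc (1 + z) `^ (2 * rb) =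
  2 `^ (ra + rb) * jacobi_weight ra rb (complex.Re z).
Proof.
move=> z1; have /andP[x1 x2] := unit_Re_itv z1.
rewrite normc_subC normc_sub1_powR// (addrC 1 z) -[X in z + X]opprK normc_add1_powR//.
rewrite !powRM; try lra.
by rewrite powRD /jacobi_weight; [ring|rewrite pnatr_eq0 implybT].
Qed.

Lemma widom_upper (ra rb : R) e : 0 <= ra -> 0 <= rb -> 0 < e ->
  exists n0, forall n, (n0 <= n)%N -> widom ra rb n <= 2 `^ (1 - ra - rb) * expR e.
Proof.
move=> ra0 rb0 e0.
have [q q0 qe] := @upper_approx (2 * ra) (2 * rb) e
  (mulr_ge0 (ler0n R 2) ra0) (mulr_ge0 (ler0n R 2) rb0) e0.
exists (size q).+1 => -[//|N]; rewrite ltnS => qN.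
have [pm ps] := cos_poly_monic q0 (leqW qN).
have E2 : (2 : R) `^ (1 - ra - rb) = 2 / 2 `^ (ra + rb).
  have -> : 1 - ra - rb = 1 + - (ra + rb) by ring.
  by rewrite [LHS]powRD ?pnatr_eq0 ?implybT// powRN powRr1.
rewrite widomE exprS E2.
have p2 : 0 < (2 : R) ^+ N by rewrite exprn_gt0.
suff : min_norm ra rb N.+1 <= 2 ^- N * (expR e / 2 `^ (ra + rb)).
  rewrite -[leRHS]mulrC ler_pdivlMr//; lra.
apply: min_norm_le pm ps _ => // x x1.
have z1 := circle_pt_unit x1.
have -> : x = complex.Re (circle_pt x) by [].
rewrite cos_poly_horner ?(leqW qN)//.
have := qe _ z1; rewrite jacobi_weight_circle// -mulrA mulrC -ler_pdivlMr ?powR_gt0//.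
set W := jacobi_weight _ _ _ => h.
rewrite normrM (ger0_norm (_ : 0 <= 2 ^- N)) ?invr_ge0 ?(ltW p2)// mulrCA.
rewrite ler_wpM2l ?invr_ge0 ?(ltW p2)//; apply: le_trans h.
rewrite ler_wpM2l ?jacobi_weight_ge0//; apply: (le_trans (normc_ge_Re _)).
by rewrite ComplexField.Normc.normcM normcX z1 expr1n mul1r normc_conj.
Qed.

End Asymptotics.

#[local] Arguments cheb : simpl never.

Section LowerAsymptotics.
Variable R : realType.
Implicit Types (p q : {poly R}) (z w : R[i]) (x y e u : R).

Definition cis u : R[i] := (cos u +i* sin u)%C.

Lemma normc_cis u : normc (cis u) = 1.
Proof. by rewrite /ComplexField.Normc.normc/= cos2Dsin2 sqrtr1. Qed.

Lemma cisX u n : cis u ^+ n = cis (n%:R * u).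
Proof.
elim: n => [|n ih]; first by rewrite expr0 mul0r /cis cos0 sin0.
rewrite exprS ih -natr1 mulrDl mul1r addrC /cis cosD sinD.
by apply/eqP; rewrite eq_complex/=; apply/andP; split; apply/eqP; ring.
Qed.

Lemma polar_right z : 0 < complex.Re z ->
  z = ((normc z)%:C)%C * cis (atan (complex.Im z / complex.Re z)).
Proof.
case: z => a b /= a0; set t := b / a.
have ct := cos_atan t.
have c0 : 0 < cos (atan t).
  by rewrite ct invr_gt0 sqrtr_gt0 ltr_wpDr ?sqr_ge0.
have st : sin (atan t) = t * cos (atan t).
  by rewrite -{2}[t]atanK /tan divfK// gt_eqF.
have n0 : normc (a +i* b)%C * cos (atan t) = a.
  have n2 : normc (a +i* b)%C = a * Num.sqrt (1 + t ^+ 2).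
    apply/eqP; rewrite -(@eqrXn2 _ 2) ?normc_ge0 ?mulr_ge0 ?sqrtr_ge0 ?(ltW a0)//.
    rewrite normc_sqr exprMn sqr_sqrtr ?addr_ge0 ?sqr_ge0//= /t.
    by apply/eqP; field; rewrite gt_eqF.
  by rewrite n2 ct mulfK// gt_eqF// sqrtr_gt0 ltr_wpDr ?sqr_ge0.
apply/eqP; rewrite eq_complex/= !mul0r subr0 addr0 n0 eqxx/= st mulrCA n0.
by rewrite /t divfK// gt_eqF.
Qed.

Definition phase q J N u :=
  N%:R * u - J%:R * atan (complex.Im (cval q (cis u)) / complex.Re (cval q (cis u))).

Lemma phase_cos q J N u : 0 < complex.Re (cval q (cis u)) ->
  complex.Re (cis u ^+ N * ((cval (q ^+ J) (cis u))^*)%C) =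
  normc (cval q (cis u)) ^+ J * cos (phase q J N u).
Proof.
rewrite /phase cvalX; move: (cval q (cis u)) => w w0; set a := atan _.
set n := normc _; rewrite (polar_right w0) -/a -/n.
have -> : (((n%:C)%C * cis a) ^+ J)^*%C = ((n ^+ J)%:C)%C * cis (- (J%:R * a)).
  rewrite exprMn -rmorphXn/= cisX /cis cosN sinN.
  by apply/eqP; rewrite eq_complex/=; apply/andP; split; apply/eqP; ring.
by rewrite cisX mulrCA ReZ ReM/= cosD cosN sinN; congr (_ * _); ring.
Qed.

Lemma Re_cval_cis q u :
  complex.Re (cval q (cis u)) = \sum_(k < size q) q`_k * cos (k%:R * u).
Proof.
rewrite (cval_expand (n := size q))// Re_sum; apply: eq_bigr => k _.
by rewrite ReZ cisX.
Qed.

Lemma Im_cval_cis q u :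
  complex.Im (cval q (cis u)) = \sum_(k < size q) q`_k * sin (k%:R * u).
Proof.
rewrite (cval_expand (n := size q))// Im_sum; apply: eq_bigr => k _.
by rewrite ImZ cisX.
Qed.

Lemma phase_continuous q J N : (forall u, 0 < complex.Re (cval q (cis u))) ->
  continuous (phase q J N).
Proof.
move=> q0 u.
have sum_cont n (f : nat -> R -> R) : (forall k, continuous (f k)) ->
    continuous (fun v => \sum_(k < n) f k v).
  move=> cf; apply: continuous_big => // -[a b].
  by apply: cvgD; [exact: cvg_fst|exact: cvg_snd].
have cRe : continuous (fun v => complex.Re (cval q (cis v))).
  have -> : (fun v => complex.Re (cval q (cis v))) =
      (fun v => \sum_(k < size q) q`_k * cos (k%:R * v)).
    by apply/funext => v; rewrite Re_cval_cis.
  apply: (sum_cont _ (fun k v => q`_k * cos (k%:R * v))) => k v.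
  apply: cvgM; first exact: cvg_cst.
  apply: (@continuous_comp R R R (fun v => k%:R * v) cos); last exact: continuous_cos.
  by apply: cvgM; [exact: cvg_cst|exact: cvg_id].
have cIm : continuous (fun v => complex.Im (cval q (cis v))).
  have -> : (fun v => complex.Im (cval q (cis v))) =
      (fun v => \sum_(k < size q) q`_k * sin (k%:R * v)).
    by apply/funext => v; rewrite Im_cval_cis.
  apply: (sum_cont _ (fun k v => q`_k * sin (k%:R * v))) => k v.
  apply: cvgM; first exact: cvg_cst.
  apply: (@continuous_comp R R R (fun v => k%:R * v) sin); last exact: continuous_sin.
  by apply: cvgM; [exact: cvg_cst|exact: cvg_id].
apply: cvgB; first by apply: cvgM; [exact: cvg_cst|exact: cvg_id].
apply: cvgM; first exact: cvg_cst.
apply: (@continuous_comp R R R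
  (fun v => complex.Im (cval q (cis v)) / complex.Re (cval q (cis v))) atan);
  last exact: continuous_atan.
apply: cvgM; first exact: cIm.
by apply: cvgV; [rewrite gt_eqF|exact: cRe].
Qed.

Lemma cos_natpi n : cos (n%:R * pi) = (-1) ^+ n :> R.
Proof.
elim: n => [|n ih]; first by rewrite mul0r cos0.
by rewrite -natr1 mulrDl mul1r cosDpi ih exprS mulN1r.
Qed.

Lemma many_roots p (f : R -> R) N : continuous f -> f 0 = 0 -> f pi = N%:R * pi ->
  (forall u j, 0 <= u <= pi -> f u = j%:R * pi -> 0 < (-1) ^+ j * p.[cos u]) ->
  (N < size p)%N.
Proof.
move=> cf f0 fpi H.
have pi0 := pi_gt0 R.
have [v [[_ _] [rs [sz us rt _]]]] : exists v, (0 <= v <= pi /\ f v = N%:R * pi) /\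
   exists rs, [/\ size rs = N, uniq rs, all (root p) rs & forall r, r \in rs -> cos v < r].
  suff : forall k, (k <= N)%N -> exists v, (0 <= v <= pi /\ f v = k%:R * pi) /\
    exists rs, [/\ size rs = k, uniq rs, all (root p) rs & forall r, r \in rs -> cos v < r].
    by apply.
  elim=> [_|k ih kN].
    exists 0; split; last by exists [::].
    by rewrite lexx (ltW pi0) f0 mul0r.
  have [v [[vpi fv] [rs [sz us rt rv]]]] := ih (ltnW kN).
  have /andP[v0 v1] := vpi.
  have [||w /=] := @IVT R f v pi (k.+1%:R * pi) v1.
  - exact: continuous_subspaceT.
  - rewrite fv fpi minEle maxEle.
    have kk : (k%:R : R) <= N%:R by rewrite ler_nat ltnW.
    rewrite ler_pM2r// kk !ler_pM2r// !ler_nat kN andbT.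
    exact: leqnSn.
  rewrite in_itv/= => /andP[vw w1] fw.
  have wpi : 0 <= w <= pi by rewrite (le_trans v0 vw).
  have nvw : v < w.
    rewrite lt_neqAle vw andbT; apply/eqP => vE; move: fw; rewrite -vE fv.
    by move=> /(mulIf (lt0r_neq0 pi0))/eqP; rewrite eqr_nat eqn_leq ltnn andbF.
  have cwv : cos w < cos v by rewrite ltr_cos// in_itv/=.
  have hv := H v k vpi fv; have hw := H w k.+1 wpi fw.
  have := @poly_ivt R ((-1) ^+ k *: p) (cos w) (cos v) (ltW cwv).
  rewrite !hornerZ (ltW hv) andbT.
  move: hw; rewrite exprS mulN1r mulNr oppr_gt0 => hw.
  rewrite (ltW hw) => /(_ isT)[r /andP[wr rv'] /rootP rr].
  exists w; split=> //.
  have pr : p.[r] = 0.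
    move: rr; rewrite hornerZ => /eqP; rewrite mulf_eq0 signr_eq0/=.
    by move/eqP.
  have rw : cos w < r.
    rewrite lt_neqAle wr andbT; apply/eqP => rE; move: hw.
    by rewrite rE pr mulr0 ltxx.
  exists (r :: rs); split=> //=.
  - by rewrite sz.
  - by rewrite us andbT; apply/negP => /rv; rewrite ltNge rv'.
  - by rewrite rt andbT; apply/rootP.
  - by move=> r'; rewrite inE => /predU1P[->//|/rv]; exact: lt_trans.
rewrite -sz; apply: max_poly_roots => //.
have := H 0 0%N; rewrite lexx (ltW pi0) f0 mul0r => /(_ isT erefl).
by rewrite expr0 mul1r; apply: contraTneq => ->; rewrite horner0 ltxx.
Qed.

Lemma size_monicB p q n : p \is monic -> q \is monic -> size p = n.+1 ->
  size q = n.+1 -> (size (p - q)%R <= n)%N.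
Proof.
move=> pm qm sp sq; apply/leq_sizeP => j; rewrite leq_eqVlt => /predU1P[<-|nj].
  have := monicP pm; have := monicP qm; rewrite !lead_coefE sp sq/= coefB => -> ->.
  by rewrite subrr.
by rewrite coefB !nth_default ?sp ?sq// subrr.
Qed.

Lemma phase_ends q J N : phase q J N 0 = 0 /\ phase q J N pi = N%:R * pi.
Proof.
have E x : complex.Im (cval q (x%:C)%C) = 0 by rewrite cval_real.
have c0 : cis 0 = (1%:C)%C by rewrite /cis cos0 sin0.
have cpi : cis pi = ((-1)%:C)%C by rewrite /cis cospi sinpi.
by rewrite /phase c0 cpi !E !mul0r atan0 !mulr0 !subr0.
Qed.

Lemma widom_lower (ra rb : R) e : 0 <= ra -> 0 <= rb -> 0 < e ->
  exists n0, forall n, (n0 <= n)%N ->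
    2 `^ (1 - ra - rb) * expR (- e) <= widom ra rb n.
Proof.
move=> ra0 rb0 e0.
have [m1 m10 ram] := nat_above ra; have [m2 m20 rbm] := nat_above rb.
pose sa := m1%:R - ra; pose sb := m2%:R - rb.
have sa0 : 0 <= sa by rewrite subr_ge0.
have sb0 : 0 <= sb by rewrite subr_ge0.
have [q [J [q0 qe]]] := @lower_approx R (2 * sa) (2 * sb) e
  (mulr_ge0 (ler0n R 2) sa0) (mulr_ge0 (ler0n R 2) sb0) e0.
exists (size (q ^+ J)).+1 => -[//|n']; rewrite ltnS => qn.
pose N := (n' + m1 + m2)%N.
have qN : (size (q ^+ J) <= N.+1)%N.
  by rewrite (leq_trans qn)// /N -addnA (leq_trans (leq_addr _ _) (leqnSn _)).
have qJ0 : (q ^+ J).[0] = 1 by rewrite horner_exp q0 expr1n.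
have [Tm Ts] := cos_poly_monic qJ0 qN.
rewrite widomE -ler_pdivrMl ?exprn_gt0//.
apply: le_min_norm => // t t1; apply: contrapT => Hn.
pose s := [seq t k | k <- enum 'I_n'.+1].
have ss : size s = n'.+1 by rewrite size_map size_enum_ord.
set K := _ * _ in Hn.
have HK x : -1 <= x <= 1 -> jacobi_weight ra rb x * `|(zpoly s).[x]| < K.
  move=> x1; rewrite ltNge; apply/negP => h; apply: Hn; exists x => //.
  by move: h; rewrite zpoly_horner big_map big_enum.
pose S := ('X - 1%:P) ^+ m1 * ('X - (-1)%:P) ^+ m2 * zpoly s.
have Sm : S \is monic by rewrite !monicMl ?monic_exp ?monicXsubC ?zpoly_monic.
have Ss : size S = N.+2.
  rewrite /S size_Mmonic ?monic_neq0 ?zpoly_monic ?monicMl ?monic_exp ?monicXsubC//.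
  rewrite size_Mmonic ?monic_neq0 ?monic_exp ?monicXsubC//.
  by rewrite !size_exp_XsubC size_zpoly ss /N !addSn !addnS/= addSn
    (addnC (m1 + m2)%N n') addnA.
have := size_monicB Tm Sm Ts Ss; rewrite leqNgt => /negP; apply.
have q1 v : 0 < complex.Re (cval q (cis v)) by case: (qe _ (normc_cis v)).
have [f0 fpi] := phase_ends q J N.+1.
apply: (many_roots (phase_continuous q1) f0 fpi) => v j _ vj.
set x := cos v; have x1 : -1 <= x <= 1 by rewrite cos_geN1 cos_le1.
have z1 := normc_cis v.
have TE : (cos_poly N (q ^+ J)).[x] =
    2 ^- N * (normc (cval q (cis v)) ^+ J * (-1) ^+ j).
  rewrite -[x]/(complex.Re (cis v)) cos_poly_horner// phase_cos// vj cos_natpi.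
  by [].
have [_] := qe _ z1; rewrite jacobi_weight_circle// -[complex.Re _]/x.
set n_ := normc _ ^+ J in TE *; set u := jacobi_weight sa sb x => qu.
have nn0 : 0 < n_.
  by rewrite exprn_gt0// normc_gt0; apply: contraTneq (q1 v) => ->; rewrite ltxx.
have uw : `|S.[x]| = u * (jacobi_weight ra rb x * `|(zpoly s).[x]|).
  rewrite /S !hornerM !normrM !horner_exp !hornerXsubC mulrA; congr (_ * _).
  have /andP[h1 h2] := x1.
  have pm (c d : R) (m : nat) : (0 < m)%N -> 0 <= c -> c ^+ m = c `^ (m%:R - d) * c `^ d.
    move=> m0 c0; rewrite -powRD ?subrK ?powR_mulrn//.
    by rewrite pnatr_eq0 -[m == 0%N]negbK -lt0n m0.
  rewrite !normrX (distrC x) opprK (addrC x) !ger0_norm; try lra.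
  rewrite (pm _ ra m1)//; last lra.
  rewrite (pm _ rb m2)//; last lra.
  by rewrite /u /jacobi_weight -/sa -/sb; ring.
have u0 : 0 <= u by exact: jacobi_weight_ge0.
have N0 : 0 < (2 : R) ^- N by rewrite invr_gt0 exprn_gt0.
have Slt : `|S.[x]| < 2 ^- N * n_.
  rewrite uw; have [->|un] := eqVneq u 0; first by rewrite mul0r mulr_gt0.
  have up : 0 < u by rewrite lt_def un.
  have := HK x x1; rewrite -(ltr_pM2l up) => /lt_le_trans; apply.
  rewrite /K expRN.
  have -> : (2 : R) `^ (1 - ra - rb) = 2 ^- (m1 + m2) * 2 * 2 `^ (sa + sb).
    have -> : 1 - ra - rb = - ((m1 + m2)%:R) + (1 + (sa + sb)).
      by rewrite /sa /sb natrD; ring.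
    have two0 (c d : R) : 2 `^ (c + d) = 2 `^ c * 2 `^ d :> R.
      by rewrite powRD// pnatr_eq0 implybT.
    by rewrite two0 (two0 1) powRr1// powR_invn// mulrA.
  have -> : (2 : R) ^- N = 2 ^- n'.+1 * (2 ^- (m1 + m2) * 2).
    by rewrite /N -addnA exprD exprS; field; rewrite !expf_neq0.
  have A0 : 0 < (2 : R) ^- n'.+1 * (2 ^- (m1 + m2) * 2).
    by rewrite !mulr_gt0 ?invr_gt0 ?exprn_gt0.
  rewrite -(ler_pM2l (expR_gt0 e)).
  have := ler_wpM2l (ltW A0) qu.
  congr (is_true (_ <= _)); last by ring.
  field; rewrite gt_eqF ?expR_gt0//.
  by rewrite !expf_neq0.
rewrite hornerD hornerN TE.
have s1 : `|(-1) ^+ j * S.[x]| < 2 ^- N * n_ by rewrite normrM normrX normrN1 expr1n mul1r.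
have := ler_norm ((-1) ^+ j * S.[x]).
have sg : (-1) ^+ j * (-1) ^+ j = 1 :> R by rewrite -expr2 sqrr_sign.
have -> : (-1) ^+ j * (2 ^- N * (n_ * (-1) ^+ j) - S.[x]) =
  (-1) ^+ j * (-1) ^+ j * (2 ^- N * n_) - (-1) ^+ j * S.[x] by ring.
by rewrite sg mul1r; lra.
Qed.

End LowerAsymptotics.

Section Main.
Variable R : realType.
Variables ra rb : R.
Hypotheses (ra0 : 0 <= ra) (rb0 : 0 <= rb).
Let c : R := 2 `^ (1 - ra - rb).

Lemma jacobi_weight_max (x : R) : 0 < ra + rb -> -1 <= x <= 1 ->
  jacobi_weight ra rb x <=
  (2 * ra / (ra + rb)) `^ ra * (2 * rb / (ra + rb)) `^ rb.
Proof.
move=> s0 /andP[x1 x2]; set s := ra + rb in s0 *.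
have bound (a y : R) : 0 <= a -> 0 <= y ->
    y `^ a <= (2 * a / s) `^ a * expR (s * y / 2 - a).
  move=> a0 y0; have := @powR_le_tangent R a (2 * a / s) y a0 y0.
  have [->|an] := eqVneq a 0.
    by move=> _; rewrite !powRr0 mul1r subr0 -[leLHS]expR0 ler_expR divr_ge0 ?mulr_ge0 ?(ltW s0).
  have ap : 0 < a by rewrite lt_def an.
  have ap2 : 0 < 2 * a / s by rewrite divr_gt0 ?mulr_gt0.
  move=> /(_ (fun=> ap2)).
  congr (is_true (_ <= _ * expR _)).
  by field; rewrite an gt_eqF.
have h1 : 0 <= 1 - x by lra.
have h2 : 0 <= 1 + x by lra.
have := ler_pM (powR_ge0 _ _) (powR_ge0 _ _) (bound _ _ ra0 h1) (bound _ _ rb0 h2).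
rewrite mulrACA -expRD.
have -> : s * (1 - x) / 2 - ra + (s * (1 + x) / 2 - rb) = 0 by rewrite /s; field.
by rewrite expR0 mulr1.
Qed.

Lemma widom0_le : 0 < ra + rb ->
  widom ra rb 0 <= (2 * ra / (ra + rb)) `^ ra * (2 * rb / (ra + rb)) `^ rb.
Proof.
move=> s0; rewrite widomE expr0 mul1r.
apply: (min_norm_le ra0 rb0 (monic1 R)); first by rewrite size_poly1.
by move=> x x1; rewrite hornerC normr1 mulr1 jacobi_weight_max.
Qed.

Lemma widom_limit_le (r : R) : (forall n, (0 < n)%N -> widom ra rb n <= r) -> c <= r.
Proof.
move=> H; apply: le_mul_expR_le => e e0.
have [n0 hn] := widom_lower ra0 rb0 e0.
have := le_trans (hn _ (leqnSn n0)) (H n0.+1 isT).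
by rewrite expRN ler_pdivrMr ?expR_gt0.
Qed.

Lemma widom_limit_ge (r : R) : (forall n, (0 < n)%N -> r <= widom ra rb n) -> r <= c.
Proof.
move=> H; apply: le_mul_expR_le => e e0.
have [n0 hn] := widom_upper ra0 rb0 e0.
exact: le_trans (H n0.+1 isT) (hn _ (leqnSn n0)).
Qed.

Lemma widom_cvg : widom ra rb n / c @[n --> \oo] --> (1 : R).
Proof.
have c0 : 0 < c by rewrite powR_gt0.
apply/cvgrPdist_lt => e e0.
have e1 : 0 < ln (1 + e / 2) by rewrite ln_gt0// ltrDl divr_gt0.
have ee : expR (ln (1 + e / 2)) = 1 + e / 2 by rewrite lnK// posrE; lra.
have [n1 h1] := widom_lower ra0 rb0 e1; have [n2 h2] := widom_upper ra0 rb0 e1.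
exists (n1 + n2)%N => // n /= nn.
have := h1 n (leq_trans (leq_addr _ _) nn); have := h2 n (leq_trans (leq_addl _ _) nn).
rewrite expRN ee -/c -ler_pdivrMl// mulrC => hu.
rewrite -ler_pdivlMl// [leRHS]mulrC => hl.
have : 1 - e / 2 <= (1 + e / 2)^-1.
  rewrite -[leRHS]mul1r ler_pdivlMr; last lra.
  by have := sqr_ge0 e; lra.
move=> hl2; rewrite ltr_norml; apply/andP; split; lra.
Qed.

Lemma widom_sup : (forall n, (0 < n)%N -> widom ra rb n <= c) ->
  ereal_sup [set (widom ra rb n)%:E | n in [set n : nat | (0 < n)%N]] = c%:E.
Proof.
move=> H; apply/eqP; rewrite eq_le; apply/andP; split.
  by apply: ge_ereal_sup => _ [n /= n0 <-]; rewrite lee_fin H.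
have ub n : (0 < n)%N -> ((widom ra rb n)%:E <=
    ereal_sup [set (widom ra rb n)%:E | n in [set n : nat | (0 < n)%N]])%E.
  by move=> n0; apply: ereal_sup_ubound; exists n.
case: (ereal_sup _) ub => [r||] ub; [|by rewrite leey|by have := ub 1%N isT].
by rewrite lee_fin; apply: widom_limit_le => n /ub; rewrite lee_fin.
Qed.

Lemma widom_inf : (forall n, (0 < n)%N -> c <= widom ra rb n) ->
  ereal_inf [set (widom ra rb n)%:E | n in [set n : nat | (0 < n)%N]] = c%:E.
Proof.
move=> H; apply/eqP; rewrite eq_le; apply/andP; split; last first.
  by apply: le_ereal_inf_tmp => _ [n /= n0 <-]; rewrite lee_fin H.
have lb n : (0 < n)%N -> (ereal_inf [set (widom ra rb n)%:E |
    n in [set n : nat | (0 < n)%N]] <= (widom ra rb n)%:E)%E.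
  by move=> n0; apply: ereal_inf_lbound; exists n.
case: (ereal_inf _) lb => [r||] lb; [|by have := lb 1%N isT|by rewrite leNye].
by rewrite lee_fin; apply: widom_limit_ge => n /lb; rewrite lee_fin.
Qed.

Hypotheses (ha : ra = 0 \/ 1 / 2 <= ra) (hb : rb = 0 \/ 1 / 2 <= rb).

Lemma widom_nonincreasing m n : (0 < m)%N -> (m <= n)%N ->
  widom ra rb n <= widom ra rb m.
Proof.
move=> m0; elim: n => [|n ih]; first by rewrite leqn0 => /eqP ->.
rewrite leq_eqVlt => /predU1P[->//|]; rewrite ltnS => mn.
apply: le_trans (ih mn); apply: widom_succ => //.
by rewrite -addrA ltr_wpDr ?addr_ge0// ltr0n (leq_trans m0).
Qed.

Lemma widom_ge n : (0 < n)%N -> c <= widom ra rb n.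
Proof.
move=> n0; apply: le_mul_expR_le => e e0.
have [n1 hn] := widom_lower ra0 rb0 e0.
have := le_trans (hn _ (leq_addl n n1)) (widom_nonincreasing n0 (leq_addr n1 n)).
by rewrite expRN ler_pdivrMr ?expR_gt0.
Qed.

End Main.

Unset Implicit Arguments.

Theorem theorem1p4 (R : realType) (ra rb : R) (hra : 0 <= ra) (hrb : 0 <= rb) :
  [/\ widom ra rb n / 2 `^ (1 - ra - rb) @[n --> \oo] --> (1 : R),
      (ra = 0 \/ ra = 1 / 2) -> (rb = 0 \/ rb = 1 / 2) ->
        forall m n : nat, (0 < m)%N -> (0 < n)%N ->
          widom ra rb m = widom ra rb n,
      0 <= ra <= 1 / 2 -> 0 <= rb <= 1 / 2 ->
        ereal_sup [set (widom ra rb n)%:E | n in [set n : nat | (0 < n)%N]]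
        = (2 `^ (1 - ra - rb))%:E
    & (ra = 0 \/ 1 / 2 <= ra) -> (rb = 0 \/ 1 / 2 <= rb) ->
        [/\ ereal_inf [set (widom ra rb n)%:E | n in [set n : nat | (0 < n)%N]]
            = (2 `^ (1 - ra - rb))%:E,
            (* the bound reads 0/0 when both parameters vanish *)
            (ra, rb) <> (0, 0) ->
            (ereal_sup [set (widom ra rb n)%:E | n in [set n : nat | (0 < n)%N]]
             <= ((2 * ra / (ra + rb)) `^ ra * (2 * rb / (ra + rb)) `^ rb)%:E)%E
          & forall m n : nat, (0 < m)%N -> (m <= n)%N ->
              widom ra rb n <= widom ra rb m]].
Proof.
split.
- exact: widom_cvg.
- move=> ha hb.
  have w n : (0 < n)%N -> widom ra rb n = 2 `^ (1 - ra - rb).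
    move=> n0; apply/eqP; rewrite eq_le; apply/andP; split.
      by apply: widom_le => //; [case: ha => ->|case: hb => ->]; lra.
    by apply: widom_ge => //;
      [case: ha => ->; [left|right]|case: hb => ->; [left|right]].
  by move=> m n m0 n0; rewrite !w.
- move=> /andP[_ ha] /andP[_ hb]; apply: widom_sup => // n.
  exact: widom_le.
- move=> ha hb; split.
  + by apply: widom_inf => // n; exact: widom_ge.
  + move=> ab0; apply: ge_ereal_sup => _ [n /= n0 <-]; rewrite lee_fin.
    have s0 : 0 < ra + rb.
      rewrite lt_neqAle addr_ge0// andbT eq_sym paddr_eq0//.
      by apply/negP => /andP[/eqP a0 /eqP b0]; apply: ab0; rewrite a0 b0.
    apply: le_trans (widom0_le hra hrb s0).
    apply: le_trans (widom_nonincreasing hra hrb ha hb (ltn0Sn 0) n0) _.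
    by apply: widom_succ => //; rewrite add0r.
  + exact: widom_nonincreasing.
Qed.
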